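(* Let $n\ge4$ and let $\Gamma$ be a simple connected graph on vertex set $\{2,\dots,n\}$. The cone complex underlying $\mathcal{M}_{0,\Gamma}^{\mathrm{rad}}$ is naturally identified (via $\Psi_\Gamma$) with $\pi_\Gamma(\mathcal{M}_{0,n}^{\mathrm{rad}})=B'(\Gamma)$ if and only if $\Gamma$ is a complete multipartite graph. In particular, in that case $\mathcal{M}_{0,\Gamma}^{\mathrm{rad}}$ has the structure of a balanced fan.
   Context: Rational $n$-marked tropical curves: metric trees with ends labeled $1,\dots,n$, bounded edges of positive length, vertices of valence $\ge3$. The root vertex $v_0$ carries end $1$. A radially aligned combinatorial type is the combinatorial type (lengths forgotten) together with the weak ordering of vertices by distance from $v_0$; $\mathcal{M}_{0,n}^{\mathrm{rad}}$ is the cone complex of radially aligned curves (refining the usual $\mathcal{M}_{0,n}^{\mathrm{trop}}$), with one cone per radially aligned combinatorial type. $\Gamma$-stability: a non-root vertex with $d$ bounded edges and end set $I$ is $\Gamma$-stable if $d>2$, or $d=2$ and $I\ne\emptyset$, or $d=1$ and some edge of $\Gamma$ joins two elements of $I$; $v_0$ is $\Gamma$-stable if it has $\ge2$ bounded edges or $\ge1$ end; a curve is $\Gamma$-stable if it is $\Gamma$-stable at all vertices. $\mathcal{M}_{0,\Gamma}^{\mathrm{rad}}$ is the cone complex parametrizing $\Gamma$-stable radially aligned rational $n$-marked curves (the locus of $\Gamma$-stable types in $\mathcal{M}_{0,n}^{\mathrm{rad}}$). For a graph $G$ with edge set $E$, $B'(G)\subseteq\mathbb{R}^{|E|}/L$,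 $L=\mathbb{R}(1,\dots,1)$, is the balanced fan (all weights $1$) whose cones are spanned by $\rho_{F_1},\dots,\rho_{F_r}$ for chains $\emptyset\subsetneq F_1\subsetneq\cdots\subsetneq F_r\subsetneq E$ of flats of the cycle matroid of $G$, $\rho_F=-\sum_{e\in F}v_e$. Flats of $K_{n-1}$ (on $\{2,\dots,n\}$) are cluster graphs $\coprod_jK_{I_j}$. There is an isomorphism $\Psi$ identifying $\mathcal{M}_{0,n}^{\mathrm{rad}}$ with $B'(K_{n-1})$ as fans, sending a radially aligned type to a chain of flats of $K_{n-1}$ (the type of a curve with $d$ equal-length bounded edges from the root to vertices with end sets $I_j$ goes to the flat $\coprod_jK_{I_j}$); it restricts to a bijection between $\Gamma$-stable radially aligned types and chains of $\Gamma$-stable flats (flats each of whose cliques $K_{I_j}$ contains an edge of $\Gamma$). $\pi_\Gamma$ is the projection forgetting coordinates of edges not in $\Gamma$, $\mathbb{R}^{|E(K_{n-1})|}/L\to\mathbb{R}^{|E(K_{n-1})|}/L/\mathrm{span}\{v_e:e\notin E(\Gamma)\}\cong\mathbb{R}^{|E(\Gamma)|}/L$, acting on flats by $F\mapsto F\cap E(\Gamma)$. $\Psi_\Gamma=\pi_\Gamma\circ\Psi\circ\iota$, where $\iota:\mathcal{M}_{0,\Gamma}^{\mathrm{rad}}\to\mathcal{M}_{0,n}^{\mathrm{rad}}$ is the inclusion. A complete multipartite graph is one whose vertex set is partitioned into independent sets with two vertices adjacent iff they lie in different parts. *)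

(* Defs.v *)
From mathcomp Require Import boolp classical_sets cardinality fsbigop reals.
From mathcomp Require Import all_boot all_order all_algebra.
Set Implicit Arguments.
Unset Strict Implicit.
Unset Printing Implicit Defensive.
Import Order.TTheory GRing.Theory Num.Theory.
Local Open Scope ring_scope.

Record sgraph (T : finType) := SGraph {
  gadj :> rel T;
  gadj_sym : symmetric gadj;
  gadj_irr : irreflexive gadj }.

Section Graphs.
Variable T : finType.
Implicit Types (G : sgraph T) (F : {set {set T}}).

Definition edges G : {set {set T}} :=
  [set e | [exists u, exists v, G u v && (e == [set u; v])]].

Definition gconnected G : Prop := forall u v, connect G u v.

(* [ucycle] also accepts the sequences [:: u; v] going back and forth along a
   single edge, hence the bound 2 on the size. *)
Definition acyclic F : Prop :=
  forall p : seq T,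
    ucycle [rel u v | (u != v) && ([set u; v] \in F)] p -> (size p <= 2)%N.

Definition is_tree G : Prop := gconnected G /\ acyclic (edges G).

(* Rank function of the cycle matroid: the independent sets are the forests. *)
Definition mrank F : nat :=
  \max_(A : {set {set T}} | (A \subset F) && `[< acyclic A >]) #|A|.

Definition flat G F : bool :=
  (F \subset edges G) &&
  [forall (e | e \in edges G :\: F), (mrank F < mrank (e |: F))%N].

Definition flat_chain G (c : seq {set {set T}}) : bool :=
  path (fun A B : {set {set T}} => A \proper B) set0 c
  && all (fun F : {set {set T}} => flat G F && (F \proper edges G)) c.

Definition complete_multipartite G : Prop :=
  exists2 P : {set {set T}}, partition P [set: T] &
    forall u v, G u v = (pblock P u != pblock P v).

Lemma complete_sym : symmetric (fun u v : T => u != v).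
Proof. by move=> u v; rewrite eq_sym. Qed.

Lemma complete_irr : irreflexive (fun u v : T => u != v).
Proof. by move=> u; rewrite eqxx. Qed.

Definition Kgraph : sgraph T := SGraph complete_sym complete_irr.

Lemma edges_subK G : edges G \subset edges Kgraph.
Proof.
apply/subsetP => e; rewrite !inE => /existsP[u /existsP[v /andP[uv /eqP->]]].
apply/existsP; exists u; apply/existsP; exists v; rewrite eqxx andbT /=.
by apply: contraTneq uv => ->; rewrite gadj_irr.
Qed.

Definition edge_of G := {e : {set T} | e \in edges G}.

Definition edge_toK G (e : edge_of G) : edge_of Kgraph :=
  exist _ (val e) (subsetP (edges_subK G) _ (valP e)).

End Graphs.

Section Ambient.
Variables (R : realType) (T : finType).
Implicit Type G : sgraph T.

Definition RE G := {ffun edge_of G -> R^o}.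

Definition ve G (e : edge_of G) : RE G := [ffun f => (f == e)%:R].

Definition Lline G : {vspace RE G} := <[ [ffun=> 1] : RE G ]>%VS.

(* R^E / L is realized on a complement of L; the quotient map is the projection
   along L, so its kernel is exactly L. *)
Definition REL G := subvs_of ((Lline G)^C)%VS.

Definition toREL G (x : RE G) : REL G :=
  vsproj ((Lline G)^C)%VS (daddv_pi ((Lline G)^C)%VS (Lline G) x).

Definition rho G (F : {set {set T}}) : REL G :=
  - \sum_(e : edge_of G | val e \in F) toREL (ve e).

(* Defined on the representative [vsval y]; restricting coordinates maps L to L,
   so the choice of the representative does not matter. *)
Definition piG G (y : REL (Kgraph T)) : REL G :=
  toREL [ffun e : edge_of G => (vsval y : RE (Kgraph T)) (edge_toK e)].

End Ambient.

Arguments rho R {T} G F.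
Arguments piG {R T} G y.

Section Fans.
Local Open Scope classical_set_scope.
Variables (R : realType) (V : vectType R).
Variable Lam : set V. (* the lattice *)
Implicit Types (s t : set V) (X : set (set V)).

Definition conic (g : seq V) : set V :=
  [set x | exists2 a : nat -> R, (forall i, 0 <= a i) &
             x = \sum_(i < size g) a i *: g`_i].

Definition rational_cone s : Prop :=
  exists2 g : seq V, (forall v, v \in g -> Lam v) & s = conic g.

Definition face t s : Prop :=
  exists2 f : 'Hom(V, R^o), (forall x, s x -> 0 <= f x) &
    t = [set x | s x /\ f x = 0].

Definition is_fan X : Prop :=
  [/\ finite_set X,
      forall s, X s -> rational_cone s,
      forall s t, X s -> face t s -> X t
    & forall s t, X s -> X t -> face (s `&` t) s /\ face (s `&` t) t].

(* The linear hull: the smallest subspace containing s. *)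
Definition lhull s : {vspace V} :=
  xget 0%VS [set U : {vspace V} | (forall x, s x -> x \in U) /\
    forall W : {vspace V}, (forall x, s x -> x \in W) -> (U <= W)%VS].

Definition cdim s : nat := \dim (lhull s).

Definition pure d X : Prop :=
  forall s, X s -> exists2 t, X t /\ cdim t = d & s `<=` t.

(* For t a facet of s: u represents the generator of (Lam :&: lhull s) modulo
   (Lam :&: lhull t) pointing into s, i.e. u is a primitive normal vector. *)
Definition primitive_normal t s (u : V) : Prop :=
  [/\ Lam u, s u &
      forall x, Lam x -> x \in lhull s -> exists k : int, x - u *~ k \in lhull t].

Definition balanced_fan X (w : set V -> nat) : Prop :=
  is_fan X /\ exists2 d, pure d X &
    forall t, X t -> (cdim t).+1 = d ->
    exists2 u : set V -> V,
      forall s, X s -> cdim s = d -> t `<=` s -> primitive_normal t s (u s) &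
      \sum_(s \in [set s | [/\ X s, cdim s = d & t `<=` s]]) u s *+ w s
        \in lhull t.

End Fans.

Section Bergman.
Local Open Scope classical_set_scope.
Variables (R : realType) (T : finType) (G : sgraph T).

Definition latticeREL : set (REL R G) :=
  [set toREL x | x in [set x : RE R G | forall e, x e \is a Num.int]].

Definition Bfan : set (set (REL R G)) :=
  [set conic [seq rho R G F | F <- c] | c in [set c | flat_chain G c]].

End Bergman.

Arguments latticeREL R {T} G.
Arguments Bfan R {T} G.

Section Metric.
Variables (R : realType) (V : finType).
Implicit Types (G : sgraph V) (l : {ffun {set V} -> R^o}).

(* The sequence of vertices following u on the path from u to v, which is
   unique when G is a tree. *)
Definition geod G (u v : V) : seq V :=
  xget [::] (fun p : seq V => [/\ path G u p, uniq (u :: p) & last u p = v]).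

Fixpoint plen l (u : V) (p : seq V) : R :=
  if p is v :: p' then l [set u; v] + plen l v p' else 0.

Definition gdist G l (u v : V) : R := plen l u (geod G u v).

End Metric.

(* The ends are labelled by [option I]: [None] is the end 1, carried by the
   root, and [I] is the set of the other labels. *)
Record curve (R : realType) (I : finType) := Curve {
  vert : finType;
  tree : sgraph vert;
  treeP : is_tree tree;
  mark : option I -> vert;
  len : {ffun {set vert} -> R^o};
  len_gt0 : forall e, e \in edges tree -> 0 < len e;
  valence_ge3 : forall v,
    (3 <= #|[set w | tree v w]| + #|[set i | mark i == v]|)%N }.

Section Curves.
Variables (R : realType) (I : finType).
Implicit Types (C D : curve R I) (G : sgraph I).

Definition vroot C : vert C := mark C None.

Definition radius C (v : vert C) : R := gdist (tree C) (len C) (vroot C) v.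

Definition curve_iso C D : Prop :=
  exists f : vert C -> vert D,
    [/\ bijective f,
        forall u v, tree D (f u) (f v) = tree C u v,
        forall i, f (mark C i) = mark D i
      & forall e, e \in edges (tree C) -> len D (f @: e) = len C e].

Definition bdeg C (v : vert C) : nat := #|[set w | tree C v w]|.

Definition ends C (v : vert C) : {set I} := [set i | mark C (Some i) == v].

(* At the root only the ends other than 1 are counted: end 1 is always there. *)
Definition gstable_at G C (v : vert C) : bool :=
  if v == vroot C then (2 <= bdeg v)%N || (ends v != set0)
  else [|| (2 < bdeg v)%N,
           (bdeg v == 2%N) && (ends v != set0)
         | (bdeg v == 1%N) && [exists i in ends v, exists j in ends v, G i j]].

Definition gstable G C : Prop := forall v : vert C, gstable_at G v.

(* D is the point with length coordinates l of the closed cone of the radially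
   aligned type of C: the lengths l may vanish, they respect the weak ordering
   of the vertices of C by distance from the root, and D is the metric tree
   obtained from (tree C, l) by identifying the vertices at distance 0. *)
Definition cone_point C (l : {ffun {set vert C} -> R^o}) D : Prop :=
  [/\ forall e, e \in edges (tree C) -> 0 <= l e,
      forall u v : vert C, radius u <= radius v ->
        gdist (tree C) l (vroot C) u <= gdist (tree C) l (vroot C) v
    & exists f : vert C -> vert D,
        [/\ forall w, exists v, f v = w,
            forall i, f (mark C i) = mark D i
          & forall u v, gdist (tree D) (len D) (f u) (f v) =
                        gdist (tree C) l u v]].

Definition rad_cone C D : Prop := exists l, cone_point (C := C) l D.

(* The labels of the ends lying beyond v, seen from the root. *)
Definition beyond C (v : vert C) : {set I} :=
  [set i | v \in vroot C :: geod (tree C) (vroot C) (mark C (Some i))].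

(* Cutting C at distance r > 0 from the root gives the disjoint union of the
   complete graphs on the sets of labels of the pieces not containing the
   root. *)
Definition cut_flat C (r : R) : {set {set I}} :=
  [set e in edges (Kgraph I) | [exists v : vert C,
     (r <= radius v) && (e \subset beyond v)]].

(* The radii 0 = r_0 < r_1 < ... < r_k of the vertices. *)
Definition radii C : seq R :=
  sort <=%R (undup [seq radius v | v <- enum (vert C)]).

(* The cone of C is simplicial with coordinates r_t - r_(t-1).  The points of its
   t-th ray are the curves with equal-length edges from the root to vertices
   carrying the blocks of [cut_flat C r_t], and Psi is linear on the cone. *)
Definition Psi C : REL R (Kgraph I) :=
  \sum_(t < (size (radii C)).-1)
     ((radii C)`_t.+1 - (radii C)`_t)
       *: rho R (Kgraph I) (cut_flat C (radii C)`_t.+1).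

Definition PsiG G C : REL R G := piG G (Psi C).

End Curves.

Arguments gstable {R I} G C.
Arguments Psi {R I} C.
Arguments PsiG {R I} G C.

Section Identification.
Local Open Scope classical_set_scope.
Variables (R : realType) (I : finType) (V : vectType R).
Implicit Types (M : curve R I -> Prop) (Phi : curve R I -> V).

(* A universe constraint prevents [curve R I] from being the carrier of a [set],
   hence predicates and images spelled out. *)
Definition image_cones Phi M : set (set V) :=
  [set s | exists2 C, M C &
           s = [set x | exists2 D, rad_cone C D & Phi D = x]].

(* Phi is an isomorphism from the cone complex of the curves in M, taken up to
   isomorphism, to the fan X: it is injective, linear on each cone, and the
   images of the cones are the cones of X. *)
Definition identifies Phi M (X : set (set V)) : Prop :=
  [/\ forall C D, M C -> M D -> Phi C = Phi D <-> curve_iso C D,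
      forall C, M C ->
        exists phi : 'Hom({ffun {set vert C} -> R^o}, V),
          forall l D, cone_point (C := C) l D -> Phi D = phi l
    & image_cones Phi M = X].

End Identification.

(* Main.v *)
(* A curve C is determined by the Gromov products of its ends with respect to the
   root: delta C i j is the distance from the root to the point where the paths to
   the ends i and j separate.  The functions so obtained are exactly the symmetric
   nonnegative functions that vanish on some pair and satisfy
   delta i k >= min (delta i j) (delta j k); D lies in the cone of C iff delta D is
   weakly increasing in delta C; and Psi C is the class of - delta C modulo L, so
   that PsiG is restriction to the edges of G.  The superlevel sets of delta C on
   the edges of G form a chain of flats and span the image of the cone of C, and
   every chain arises from a stable curve, whatever G is.  So everything depends on
   injectivity.  For G complete multipartite and i, j in the same part, stability
   provides a common neighbour u of i and j whose products with i and j are at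
   least delta i j, so that delta i j is determined by its values on edges.
   Otherwise there are u adjacent to w and v adjacent to neither, and the curves
   with one non-root vertex carrying {u, w}, resp. {u, v, w}, have the same image.
   The fan of chains of flats is balanced because the flats covering a flat F
   partition the complement of F. *)
From HB Require Import structures.
Require Import Defs.
From mathcomp Require Import boolp classical_sets cardinality fsbigop reals.
From mathcomp Require Import all_boot all_order all_algebra.
From mathcomp Require Import ring lra zify.
Set Implicit Arguments.
Unset Strict Implicit.
Unset Printing Implicit Defensive.
Import Order.TTheory GRing.Theory Num.Theory.
Local Open Scope ring_scope.

(** * Acyclic edge sets *)

(** The cycle matroid is handled through connectivity: a set of edges of [G] is a flat iff it
    contains every edge of [G] whose ends it joins, and ranks only count the steps of chains.
    Because of valence 3 every vertex of a curve is the separation point of two distinct ends, so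
    the ancestor order and the maps between curves can be expressed by [delta]. The value
    [delta i i] is the largest [delta i j] with [j] different from [i]; hence only pairs of distinct
    labels carry data, and curves are constructed from these alone. Two properties make the quotient
    by [L] harmless for injectivity: [delta] is nonnegative and, [G] being connected, it vanishes on
    some edge of [G], so that equal classes mean equal values on all edges. The linear algebra of a
    cone rests on choosing an edge that enters at each step of the chain: differences of the
    coordinates at consecutive such edges are integral functionals dual to the generators, which
    gives independence, faces and primitive normal vectors. *)

Section EdgeSets.
Variable T : finType.
Implicit Types (G : sgraph T) (A F : {set {set T}}) (u v w x y : T).

Definition erel F := [rel u v : T | (u != v) && ([set u; v] \in F)].

Lemma erel_sym F : symmetric (erel F).
Proof. by move=> u v; rewrite /= eq_sym setUC. Qed.

Lemma erel_csym F : connect_sym (erel F).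
Proof. exact/sym_connect_sym/erel_sym. Qed.

Lemma set2_eq u v x y :
  [set u; v] = [set x; y] -> (u = x /\ v = y) \/ (u = y /\ v = x).
Proof.
move=> E.
have /orP[/eqP ux|/eqP uy] : (u == x) || (u == y) by rewrite -in_set2 -E set21.
  have /orP[/eqP vx|/eqP vy] : (v == x) || (v == y) by rewrite -in_set2 -E set22.
    have : y \in [set u; v] by rewrite E set22.
    by rewrite ux vx !inE orbb => /eqP ->; left.
  by left.
have /orP[/eqP vx|/eqP vy] : (v == x) || (v == y) by rewrite -in_set2 -E set22.
  by right.
have : x \in [set u; v] by rewrite E set21.
by rewrite uy vy !inE orbb => /eqP ->; left.
Qed.

Lemma edgesE G u v : ([set u; v] \in edges G) = G u v.
Proof.
rewrite inE; apply/existsP/idP => [[x /existsP[y /andP[xy /eqP/set2_eq]]]|uv].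
  by case=> -[-> ->] //; rewrite gadj_sym.
by exists u; apply/existsP; exists v; rewrite uv eqxx.
Qed.

Lemma edgesP G e : reflect (exists u v, G u v /\ e = [set u; v]) (e \in edges G).
Proof.
apply: (iffP idP) => [|[u [v [uv ->]]]]; last by rewrite edgesE.
by rewrite inE => /existsP[u /existsP[v /andP[uv /eqP ->]]]; exists u, v.
Qed.

Lemma gadj_neq G u v : G u v -> u != v.
Proof. by apply: contraTneq => ->; rewrite gadj_irr. Qed.

Lemma erel_edges G : erel (edges G) =2 G.
Proof.
move=> u v /=; rewrite edgesE; case: eqVneq => //= ->.
by rewrite gadj_irr.
Qed.

Lemma connect_erel_sub A F : A \subset F ->
  subrel (connect (erel A)) (connect (erel F)).
Proof.
move=> /subsetP AF; apply: connect_sub => u v /andP[uv uvA].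
by apply: connect1; rewrite /= uv AF.
Qed.

Lemma connect_erelU1 F x y u v : connect (erel ([set x; y] |: F)) u v ->
  [\/ connect (erel F) u v,
      connect (erel F) u x /\ connect (erel F) y v
    | connect (erel F) u y /\ connect (erel F) x v].
Proof.
move=> /connectP[p]; elim: p u => [|w p IHp] u /=.
  by move=> _ ->; apply: Or31.
case/andP=> /andP[uw]; rewrite in_setU1 => uwF /IHp{}IHp /IHp{IHp} wv.
have {uwF uw}[uw|[]|[]] : [\/ connect (erel F) u w, u = x /\ w = y | u = y /\ w = x].
- case/orP: uwF => [/eqP/set2_eq|uwF]; last by apply/Or31/connect1/andP.
  by case; [apply: Or32|apply: Or33].
- case: wv => [wv|[wx yv]|[wy xv]].
  + by apply/Or31/(connect_trans uw).
  + by apply/Or32; rewrite (connect_trans uw).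
  + by apply/Or33; rewrite (connect_trans uw).
- move=> -> eqw; rewrite eqw in wv.
  case: wv => [yv|[yx yv]|[_ xv]]; by [apply/Or32|apply/Or31].
- move=> -> eqw; rewrite eqw in wv.
  case: wv => [yv|[yx yv]|[_ xv]]; by [apply/Or33|apply/Or31].
Qed.

Lemma connect_inv (e : rel T) (P : T -> Prop) x y :
  (forall a b, e a b -> P a -> P b) -> connect e x y -> P x -> P y.
Proof.
move=> eP /connectP[p + ->]; elim: p x => //= a p IHp x /andP[xa ap] Px.
exact: IHp ap (eP _ _ xa Px).
Qed.

Lemma connect_upath (e : rel T) u v : connect e u v ->
  exists p, [/\ path e u p, uniq (u :: p) & last u p = v].
Proof.
by case/connectP=> p0 p0P ->; case/shortenP: p0P => p pP up _; exists p.
Qed.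

(** Every edge of a forest is a bridge: an edge closes any simple path around it to a cycle, and a
    cycle offers such a detour around its closing edge. Unlike cycles as sequences, this form
    behaves well when edges are added or removed. *)
Lemma acyclicP F : acyclic F <->
  forall u v, u != v -> [set u; v] \in F -> ~ connect (erel (F :\ [set u; v])) u v.
Proof.
split=> [acF u v uv uvF /connect_upath[p [pP up v0]]|bridge].
  rewrite -{}v0 in uv uvF pP *.
  have subF : subrel (erel (F :\ [set u; last u p])) (erel F).
    by move=> a b /= /andP[-> ]; rewrite !inE => /andP[].
  have lu : erel F (last u p) u by rewrite /= eq_sym uv setUC.
  have /acF : ucycle (erel F) (u :: p).
    by apply/andP; split; rewrite // /cycle rcons_path (sub_path subF pP).
  (* A detour with a single step would be the removed edge, so the cycle has at least three
     vertices. *)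
  case: p pP uv uvF {subF lu up} => [|a [|b p]] //=.
    by rewrite eqxx.
  by rewrite !inE eqxx !andbF.
case=> [|x p] //; rewrite /ucycle /= rcons_path => /andP[/andP[xp lx] up].
rewrite leqNgt; apply/negP => szp.
have lNx : last x p != x by case/andP: lx.
apply: (bridge x (last x p)); rewrite 1?eq_sym //.
  by case/andP: lx => _; rewrite setUC.
apply/connectP; exists p => //.
case: p xp lx up szp lNx => [|a [|b p]] // xp lx up _ lNx.
(* The cycle meets [x] only at its start, so no step after the first is the closing edge; the first
   is not either, because [a] is not the last vertex. *)
have E : forall y q, path (erel F) y q -> y != x -> x \notin q ->
    path (erel (F :\ [set x; last x [:: a, b & p]])) y q.
  move=> y q; elim: q y => //= c q IH y /andP[/andP[yc ycF] cq] yx.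
  rewrite inE negb_or => /andP[xc xq].
  rewrite IH ?(eq_sym c) // andbT yc /= !inE ycF andbT.
  apply/eqP => /set2_eq[[E _]|[_ E]]; first by rewrite E eqxx in yx.
  by rewrite E eqxx in xc.
have {}E := E a (b :: p); cbn [path] in xp |- *.
case/andP: xp => /andP[xa xaF] abp; apply/andP; split; last first.
  have /andP[xap _] := up; move: xap; rewrite inE negb_or => /andP[xNa xp].
  by apply: E; rewrite // eq_sym.
rewrite /erel /= xa !inE xaF andbT; apply/eqP => /set2_eq[[_ E1]|[E1 _]].
  move: up; rewrite E1 /= => /and3P[_ + _].
  by rewrite mem_last.
by rewrite E1 /= eqxx in lNx.
Qed.

Lemma acyclicS A F : A \subset F -> acyclic F -> acyclic A.
Proof.
move=> AF /acyclicP acF; apply/acyclicP => u v uv uvA.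
have /acF := subsetP AF _ uvA => /(_ uv) H C; apply: H.
exact: connect_erel_sub (setSD _ AF) _ _ C.
Qed.

(** A detour around an old edge has to use the new one; together with the old edge it would join [x]
    and [y] inside [A]. *)
Lemma acyclicU1 A x y : acyclic A -> ~~ connect (erel A) x y ->
  acyclic ([set x; y] |: A).
Proof.
move=> /acyclicP acA nxy; apply/acyclicP => u v uv.
have nxyA : [set x; y] \notin A.
  apply: contraNN nxy => xyA; case: (eqVneq x y) => [->|xNy]; first exact: connect0.
  by apply: connect1; rewrite /= xNy.
have [/set2_eq E _|Ne uvA] := eqVneq [set u; v] [set x; y].
  move=> C; move: nxy; rewrite (_ : connect _ _ _ = connect (erel A) u v).
    suff -> : A = ([set x; y] |: A) :\ [set u; v] by rewrite C.
    have -> : [set u; v] = [set x; y] by case: E => -[-> ->] //; rewrite setUC.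
    by rewrite setU1K.
  by case: E => -[-> ->] //; rewrite erel_csym.
move: uvA; rewrite in_setU1 (negPf Ne) /= => uvA.
rewrite setDUl (_ : [set _] :\: _ = [set [set x; y]]); last first.
  by apply/setDidPl; rewrite disjoints1 inE eq_sym.
have cl := connect_erel_sub (subD1set A [set u; v]).
have uv1 : connect (erel A) u v by apply: connect1; rewrite /= uv.
case/connect_erelU1 => [|[ux yv]|[uy xv]]; first exact: acA.
- case/negP: nxy; rewrite erel_csym; apply: connect_trans (cl _ _ yv) _.
  by rewrite erel_csym in uv1; apply: connect_trans uv1 (cl _ _ ux).
- case/negP: nxy; apply: connect_trans (cl _ _ xv) _.
  by rewrite erel_csym in uv1; apply: connect_trans uv1 (cl _ _ uy).
Qed.

(** Where the paths diverge, the first edge of one is bypassed by the rest of that path followed by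
    the other one backwards. *)
Lemma acyclic_uniq_path F u p q : acyclic F ->
  path (erel F) u p -> path (erel F) u q -> uniq (u :: p) -> uniq (u :: q) ->
  last u p = last u q -> p = q.
Proof.
move=> /acyclicP acF.
elim: p u q => [|x p IHp] u [|y q] //.
- by move=> _ _ _ /= /andP[uq _] E; rewrite E mem_last in uq.
- by move=> _ _ /= /andP[uq _] _ E; rewrite -E mem_last in uq.
move=> /= /andP[ux xp] /andP[uy yq] /andP[uxp uniqp] /andP[uyq uniqq] E.
have [xy|xNy] := eqVneq x y.
  by rewrite -xy in yq uniqq E *; rewrite (IHp x q).
case/andP: (ux) => uNx uxF; case: (acF u x uNx uxF).
have avoid : forall z r, u \notin z :: r -> path (erel F) z r ->
    connect (erel (F :\ [set u; x])) z (last z r).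
  move=> z r ur zr; apply/connectP; exists r => //.
  elim: r z ur zr => //= c r IH z; rewrite !inE !negb_or.
  move=> /and3P[uz uc ur] /andP[/andP[zc zcF] cr].
  rewrite IH ?inE ?negb_or ?uc // andbT zc zcF andbT /=.
  apply/eqP => /set2_eq[[e1 _]|[_ e1]]; by rewrite e1 eqxx in uc uz.
have xl := avoid x p uxp xp; have yl := avoid y q uyq yq.
rewrite erel_csym in yl; rewrite E in xl.
rewrite erel_csym; apply: connect_trans xl (connect_trans yl _).
apply: connect1; case/andP: uy => uNy uyF; rewrite /= eq_sym uNy !inE setUC uyF.
rewrite andbT; apply/eqP => /set2_eq[[_ e1]|[e1 _]]; last by rewrite e1 eqxx in uNx.
by rewrite e1 eqxx in xNy.
Qed.

End EdgeSets.

(** * The cycle matroid of a graph *)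

Section CycleMatroid.
Variable T : finType.
Implicit Types (G : sgraph T) (A F H : {set {set T}}) (u v w x y : T).

Lemma acyclic0 : acyclic (set0 : {set {set T}}).
Proof. by apply/acyclicP => u v _; rewrite inE. Qed.

Lemma mrank_max A F : A \subset F -> acyclic A -> (#|A| <= mrank F)%N.
Proof.
move=> AF acA; rewrite /mrank (bigD1 A) ?leq_maxl //=.
by rewrite AF; apply/asboolP.
Qed.

Lemma mrank_ex F : exists A, [/\ A \subset F, acyclic A & #|A| = mrank F].
Proof.
pose P (A : {set {set T}}) := (A \subset F) && `[< acyclic A >].
have P0 : P set0 by rewrite /P sub0set; apply/asboolP/acyclic0.
have : (0 < #|P|)%N by apply/card_gt0P; exists set0.
move=> /(bigop.eq_bigmax_cond (fun A : {set {set T}} => #|A|))[A].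
by move=> /andP[AF /asboolP acA] E; exists A; split.
Qed.

Lemma mrankS A F : A \subset F -> (mrank A <= mrank F)%N.
Proof.
move=> AF; have [B [BA acB <-]] := mrank_ex A.
exact/mrank_max/acB/(subset_trans BA).
Qed.

Lemma mrank0 : mrank (set0 : {set {set T}}) = 0%N.
Proof.
have [B [+ _ <-]] := mrank_ex set0.
by rewrite subset0 => /eqP ->; rewrite cards0.
Qed.

Lemma mrankU1_le e F : (mrank (e |: F) <= (mrank F).+1)%N.
Proof.
have [A [AF acA <-]] := mrank_ex (e |: F).
rewrite (cardsD1 e A) -add1n leq_add ?leq_b1 // mrank_max ?subDset //.
exact/(acyclicS _ acA)/subD1set.
Qed.

(** Basis exchange: if a largest forest uses the new edge, removing it separates [u] from [v], and a
    walk from [u] to [v] in [F] contains an edge that can replace it. *)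
Lemma mrankU1_connect F u v : u != v -> connect (erel F) u v ->
  mrank ([set u; v] |: F) = mrank F.
Proof.
move=> uNv uv; apply/eqP; rewrite eqn_leq (mrankS (subsetUr _ _)) andbT.
have [A [AF acA <-]] := mrank_ex ([set u; v] |: F).
have [eA|eNA] := boolP ([set u; v] \in A); last first.
  apply: mrank_max => //; apply/subsetP => e eA; move: (subsetP AF e eA).
  by rewrite in_setU1 => /orP[/eqP ee|//]; rewrite -ee eA in eNA.
have acA' : acyclic (A :\ [set u; v]) by apply: acyclicS acA; apply: subD1set.
have nuv := proj1 (acyclicP A) acA u v uNv eA.
have [a [b [/andP[aNb abF] nab]]] : exists a b,
    erel F a b /\ ~~ connect (erel (A :\ [set u; v])) a b.
  apply: contrapT => /forallNP E; apply: nuv; apply: connect_sub uv => a b ab.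
  by apply/negPn/negP => nab; case: (E a); exists b.
have acA2 := acyclicU1 acA' nab.
have abNA : [set a; b] \notin A :\ [set u; v].
  by apply: contraNN nab => abA; apply: connect1; apply/andP.
have -> : #|A| = #|[set a; b] |: (A :\ [set u; v])|.
  by rewrite cardsU1 abNA (cardsD1 [set u; v] A) eA.
by apply: mrank_max => //; rewrite subUset sub1set abF subDset.
Qed.

Lemma mrankU1_nconnect F u v : ~~ connect (erel F) u v ->
  mrank ([set u; v] |: F) = (mrank F).+1.
Proof.
move=> nuv; apply/eqP; rewrite eqn_leq mrankU1_le /=.
have [A [AF acA <-]] := mrank_ex F.
have nuvA : ~~ connect (erel A) u v.
  by apply: contraNN nuv => /(connect_erel_sub AF).
have uvNA : [set u; v] \notin A.
  apply: contraNN nuvA => uvA; have [->|uNv] := eqVneq u v.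
    exact: connect0.
  by apply: connect1; apply/andP.
rewrite -add1n -[1%N]/(nat_of_bool true) -[true]uvNA -cardsU1 mrank_max ?setUS //.
exact: acyclicU1.
Qed.

(** The rank grows exactly when the new edge joins two components, so the rank condition says that
    no missing edge of [G] has both ends in one component. *)
Lemma flatP G F : reflect (F \subset edges G /\
   forall u v, G u v -> connect (erel F) u v -> [set u; v] \in F) (flat G F).
Proof.
apply: (iffP andP) => -[FG flF]; split => //.
  move=> u v uv Cuv; apply: contraTT flF => uvF.
  rewrite negb_forall; apply/existsP; exists [set u; v].
  by rewrite in_setD uvF edgesE uv /= mrankU1_connect ?ltnn // (gadj_neq uv).
apply/forall_inP => e; rewrite in_setD => /andP[eF /edgesP[u [v [uv ee]]]].
rewrite ee in eF *; rewrite mrankU1_nconnect //.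
by apply: contraNN eF; apply: flF.
Qed.

Lemma flat_sub G F : flat G F -> F \subset edges G.
Proof. by case/flatP. Qed.

Lemma flat0 G : flat G set0.
Proof.
apply/flatP; split=> [|u v uv /connectP[[|w p] /=]]; first exact: sub0set.
  by move=> _ E; rewrite E gadj_irr in uv.
by rewrite inE andbF.
Qed.

Lemma flat_edges G : flat G (edges G).
Proof. by apply/flatP; split=> // u v uv _; rewrite edgesE. Qed.

Definition closure G F : {set {set T}} :=
  [set e in edges G | [exists u, exists v,
     (e == [set u; v]) && connect (erel F) u v]].

Lemma closureE G F u v : G u v ->
  ([set u; v] \in closure G F) = connect (erel F) u v.
Proof.
move=> uv; rewrite inE edgesE uv /=; apply/existsP/idP => [[x]|C]; last first.
  by exists u; apply/existsP; exists v; rewrite eqxx.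
case/existsP=> y /andP[/eqP/set2_eq[[-> ->]|[-> ->]]] //.
by rewrite erel_csym.
Qed.

Lemma closure_sub G F : closure G F \subset edges G.
Proof. by apply/subsetP => e; rewrite inE => /andP[]. Qed.

Lemma sub_closure G F : F \subset edges G -> F \subset closure G F.
Proof.
move=> FG; apply/subsetP => e eF; have /edgesP[u [v [uv ee]]] := subsetP FG _ eF.
rewrite ee in eF *; rewrite closureE //; apply: connect1.
by rewrite /= (gadj_neq uv).
Qed.

Lemma connect_closure G F : F \subset edges G ->
  connect (erel (closure G F)) =2 connect (erel F).
Proof.
move=> FG u v; apply/idP/idP; last exact/connect_erel_sub/sub_closure.
apply: connect_sub => x y /andP[xy xyF].
by rewrite -(@closureE G) // -edgesE (subsetP (closure_sub G F)).
Qed.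

Lemma flat_closure G F : F \subset edges G -> flat G (closure G F).
Proof.
move=> FG; apply/flatP; split=> [|u v uv]; first exact: closure_sub.
by rewrite connect_closure // closureE.
Qed.

Lemma closure_min G F H : flat G H -> F \subset H -> closure G F \subset H.
Proof.
case/flatP=> HG flH FH; apply/subsetP => e eF.
have /edgesP[u [v [uv ee]]] := subsetP (closure_sub G F) _ eF.
rewrite ee closureE // in eF; rewrite ee flH //.
exact: connect_erel_sub FH _ _ eF.
Qed.

Lemma mrank_closure G F : F \subset edges G -> mrank (closure G F) = mrank F.
Proof.
move=> FG; have FC := sub_closure FG.
(* Generalized to every set between [F] and its closure, so that the edges outside [F] can be
   removed one at a time. *)
suff E H : F \subset H -> H \subset closure G F -> mrank H = mrank F by apply: E.
have [n le_n] := ubnP #|H :\: F|; elim: n H le_n => // n IHn H le_n FH HC.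
have [HF|] := boolP (H \subset F).
  by have /eqP -> : H == F by rewrite eqEsubset HF.
case/subsetPn=> e eH eF; have /edgesP[u [v [uv ee]]] :=
  subsetP (subset_trans HC (closure_sub G F)) _ eH.
have FH' : F \subset H :\ e by rewrite subsetD1 FH.
have HH' := subD1set H e.
rewrite -(IHn (H :\ e)) ?(subset_trans HH' HC) //; last first.
  apply: leq_trans (le_n : (#|H :\: F| <= n)%N); apply: proper_card.
  rewrite properE setSD //=; apply/subsetPn.
  by exists e; rewrite !inE ?eqxx ?eH ?eF.
rewrite -{1}(setD1K eH) ee mrankU1_connect ?(gadj_neq uv) //.
rewrite ee in FH'; apply: (connect_erel_sub FH').
by rewrite -(closureE F uv) -ee (subsetP HC).
Qed.

Lemma mrank_flat_proper G F H : flat G F -> flat G H -> F \proper H ->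
  (mrank F < mrank H)%N.
Proof.
move=> flF flH /properP[FH [e eH eF]].
have /edgesP[u [v [uv ee]]] := subsetP (flat_sub flH) _ eH.
rewrite ee in eH eF; apply: leq_trans (_ : mrank ([set u; v] |: F) <= _)%N.
  rewrite mrankU1_nconnect //; apply: contraNN eF.
  by have [_] := flatP _ _ flF; apply.
by rewrite mrankS // subUset sub1set eH.
Qed.

(** Closing does not change the rank, so one edge added to a flat generates a flat exactly one rank
    higher, the smallest one containing [F] and [e]. *)
Lemma flat_cover G F H e : flat G F -> flat G H -> F \subset H ->
    e \in H -> e \notin F ->
  [/\ flat G (closure G (e |: F)), F \proper closure G (e |: F),
      e \in closure G (e |: F), closure G (e |: F) \subset H
    & mrank (closure G (e |: F)) = (mrank F).+1].
Proof.
move=> flF flH FH eH eF; have HG := flat_sub flH.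
have eFG : e |: F \subset edges G.
  by rewrite subUset sub1set (subsetP HG) //= (subset_trans FH).
have sC := sub_closure eFG.
have eC : e \in closure G (e |: F) by rewrite (subsetP sC) // setU11.
split=> //.
- exact: flat_closure.
- apply/properP; split; last by exists e.
  by apply: subset_trans sC; apply: subsetUr.
- by apply: closure_min => //; rewrite subUset sub1set eH.
- rewrite mrank_closure //.
  have /edgesP[u [v [uv ee]]] := subsetP HG _ eH.
  rewrite ee mrankU1_nconnect //; apply: contraNN eF; rewrite ee.
  by have [_] := flatP _ _ flF; apply.
Qed.

(* Hence the flats covering F partition the complement of F. *)
Lemma flat_cover_uniq G F H e : flat G F -> flat G H -> F \subset H ->
  e \in H -> e \notin F -> mrank H = (mrank F).+1 -> H = closure G (e |: F).
Proof.
move=> flF flH FH eH eF rH; have [flC FC eC CH rC] := flat_cover flF flH FH eH eF.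
apply/eqP; rewrite eq_sym; apply: contraTT isT => CNH.
have := mrank_flat_proper flC flH; rewrite properEneq CNH CH => /(_ isT).
by rewrite rC rH ltnn.
Qed.

End CycleMatroid.

(** * Rooted trees *)

Section CommonPrefix.
Variable T : eqType.
Implicit Types p q s : seq T.

Fixpoint lcp p q : seq T :=
  match p, q with
  | x :: p', y :: q' => if x == y then x :: lcp p' q' else [::]
  | _, _ => [::]
  end.

Lemma lcpC p q : lcp p q = lcp q p.
Proof.
elim: p q => [|x p IHp] [|y q] //=; rewrite eq_sym.
by case: eqP => // ->; rewrite IHp.
Qed.

Lemma prefix_lcp s p q : prefix s (lcp p q) = prefix s p && prefix s q.
Proof.
elim: p q s => [|x p IHp] [|y q] [|z s]; rewrite ?prefix0s //= ?andbF //.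
case: (eqVneq x y) => [<-|xNy] /=.
  by rewrite IHp andbACA andbb.
case: (eqVneq z x) => //= zx; case: eqVneq => //= zy; last by rewrite andbF.
by rewrite -zx -zy eqxx in xNy.
Qed.

Lemma lcp_split p q : exists p' q',
  [/\ p = lcp p q ++ p', q = lcp p q ++ q' &
      forall x y r s, p' = x :: r -> q' = y :: s -> x != y].
Proof.
elim: p q => [|x p IHp] [|y q] /=.
- by exists [::], [::].
- by exists [::], (y :: q).
- by exists (x :: p), [::].
case: eqVneq => [<-|xNy]; last first.
  by exists (x :: p), (y :: q); split=> // ? ? ? ? [<- _] [<- _].
have [p' [q' [Ep Eq dpq]]] := IHp q.
by exists p', q'; rewrite /= -Ep -Eq.
Qed.

Lemma prefix_total s1 s2 p :
  prefix s1 p -> prefix s2 p -> prefix s1 s2 || prefix s2 s1.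
Proof.
elim: p s1 s2 => [|z p IHp] [|x s1] [|y s2] //=; rewrite ?orbT //.
by case/andP=> /eqP -> ? /andP[/eqP -> ?]; rewrite eqxx IHp.
Qed.

Lemma prefix_anti s1 s2 : prefix s1 s2 -> prefix s2 s1 -> s1 = s2.
Proof.
case/prefixP=> t -> /size_prefix; rewrite size_cat -{2}[size s1]addn0 leq_add2l.
by rewrite leqn0 => /nilP ->; rewrite cats0.
Qed.

End CommonPrefix.

Section PathLength.
Variables (R : realType) (T : finType).
Implicit Types (l : {ffun {set T} -> R^o}) (u : T) (p q : seq T).

Lemma plen_cat l u p q : plen l u (p ++ q) = plen l u p + plen l (last u p) q.
Proof.
elim: p u => [|v p IHp] u /=; first by rewrite add0r.
by rewrite IHp addrA.
Qed.

Lemma last_rev_belast u p : last (last u p) (rev (belast u p)) = u.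
Proof. by case: p => [|w p] //=; rewrite rev_cons last_rcons. Qed.

Lemma plen_rev l u p : plen l (last u p) (rev (belast u p)) = plen l u p.
Proof.
elim: p u => [|v p IHp] u //=.
rewrite rev_cons -cats1 plen_cat IHp /= addr0 addrC setUC.
by rewrite last_rev_belast.
Qed.

End PathLength.

(** * Stems, ancestors and meets in a rooted tree *)

Section RootedTree.
Variables (T : finType) (G : sgraph T) (root : T).
Hypothesis treeG : is_tree G.
Implicit Types (a b u v w : T) (p q : seq T).

Lemma geodP u v :
  [/\ path G u (geod G u v), uniq (u :: geod G u v) & last u (geod G u v) = v].
Proof.
rewrite /geod; case: xgetP => // nE.
have [p pP] := connect_upath (proj1 treeG u v).
by case: (nE p).
Qed.

Lemma geod_uniq u v p :
  path G u p -> uniq (u :: p) -> last u p = v -> geod G u v = p.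
Proof.
have [gp gu gl] := geodP u v => pp up pl.
apply: (acyclic_uniq_path (u := u) (proj2 treeG)) => //; last by rewrite pl gl.
- by rewrite (eq_path (erel_edges G)).
- by rewrite (eq_path (erel_edges G)).
Qed.

Lemma geod_adj u v : G u v -> geod G u v = [:: v].
Proof.
move=> uv; apply: geod_uniq; rewrite //= ?uv // inE andbT.
exact: gadj_neq uv.
Qed.

Lemma geodxx u : geod G u u = [::].
Proof. exact: geod_uniq. Qed.

(** A vertex is encoded by the path from the root to it, so that ancestors become prefixes and meets
    become longest common prefixes. *)
Definition stem v : seq T := geod G root v.

Definition anc a v : bool := prefix (stem a) (stem v).

Lemma stem_root : stem root = [::].
Proof. exact: geodxx. Qed.

Lemma last_stem v : last root (stem v) = v.
Proof. by have [] := geodP root v. Qed.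

Lemma path_stem v : path G root (stem v).
Proof. by have [] := geodP root v. Qed.

Lemma uniq_stem v : uniq (root :: stem v).
Proof. by have [] := geodP root v. Qed.

Lemma stem_inj : injective stem.
Proof. by move=> u v E; rewrite -(last_stem u) E last_stem. Qed.

Lemma stem_prefix p q v : stem v = p ++ q -> stem (last root p) = p.
Proof.
move=> E; have := path_stem v; have := uniq_stem v.
rewrite E cat_path -cat_cons cat_uniq => /andP[up _] /andP[pp _].
exact: geod_uniq.
Qed.

Lemma stem_catE p q v : stem v = p ++ q -> geod G (last root p) v = q.
Proof.
move=> E; have := path_stem v; have := uniq_stem v; have := last_stem v.
rewrite E cat_path last_cat => lq; rewrite -cat_cons lastI cat_rcons cat_uniq.
by move=> /and3P[_ _ uq] /andP[_ pq]; apply: geod_uniq.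
Qed.

Lemma ancE a v : anc a v = (a \in root :: stem v).
Proof.
apply/idP/idP => [/prefixP[q E]|].
  by rewrite E -cat_cons mem_cat -{1}(last_stem a) mem_last.
case/splitPl E : (stem v) / => [p q lp].
by rewrite /anc E -lp (stem_prefix E) prefix_prefix.
Qed.

Lemma anc_refl v : anc v v. Proof. exact: prefix_refl. Qed.

Lemma anc_root v : anc root v. Proof. by rewrite ancE mem_head. Qed.

Lemma anc_trans a u v : anc a u -> anc u v -> anc a v.
Proof. exact: prefix_trans. Qed.

Lemma anc_anti a v : anc a v -> anc v a -> a = v.
Proof. by move=> av va; apply/stem_inj/prefix_anti. Qed.

Lemma anc_total a b v : anc a v -> anc b v -> anc a b || anc b a.
Proof. exact: prefix_total. Qed.

Definition child a w : bool := stem w == rcons (stem a) w.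

Lemma child_adj a w : child a w -> G a w.
Proof.
move=> /eqP E; have := path_stem w.
by rewrite E rcons_path last_stem => /andP[].
Qed.

Lemma child_anc a w : child a w -> anc a w.
Proof. by move=> /eqP E; rewrite /anc E prefix_rcons. Qed.

Lemma child_Nanc a w : child a w -> ~~ anc w a.
Proof.
move=> cw; apply/negP => wa; have := gadj_neq (child_adj cw).
by rewrite (anc_anti (child_anc cw) wa) eqxx.
Qed.

Lemma adj_child u v : G u v -> child u v || child v u.
Proof.
move=> uv; have [|vNu] := boolP (anc v u).
  case/prefixP=> q E; have := stem_catE E.
  rewrite last_stem geod_adj 1?gadj_sym // => Eq.
  by rewrite /child E -Eq cats1 eqxx orbT.
rewrite /child [stem v](_ : _ = rcons (stem u) v) ?eqxx //.
apply: geod_uniq; rewrite ?last_rcons //.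
  by rewrite rcons_path path_stem last_stem.
by rewrite -rcons_cons rcons_uniq -ancE vNu uniq_stem.
Qed.

Lemma anc_next a v : anc a v -> a != v -> exists2 w, child a w & anc w v.
Proof.
case/prefixP=> [[|w q] E aNv].
  by rewrite cats0 in E; rewrite (stem_inj E) eqxx in aNv.
rewrite -cat_rcons in E; have := stem_prefix E; rewrite last_rcons => Ew.
by exists w; rewrite /child /anc Ew // E prefix_prefix.
Qed.

Lemma child_uniq a w w' v :
  child a w -> child a w' -> anc w v -> anc w' v -> w = w'.
Proof.
move=> /eqP E /eqP E' /prefixP[q Eq] /prefixP[q' Eq'].
move: Eq'; rewrite Eq E E' !cat_rcons => /eqP.
by rewrite eqseq_cat // eqxx /= => /andP[/eqP].
Qed.

Lemma parent_uniq a b w : child a w -> child b w -> a = b.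
Proof.
move=> /eqP Ea /eqP Eb; apply: stem_inj.
by move: Ea; rewrite Eb => /rcons_inj[].
Qed.

Lemma parent_ex v : v != root -> exists a, child a v.
Proof.
move=> vr; case/lastP E : (stem v) => [|p w].
  by rewrite -stem_root in E; rewrite (stem_inj E) eqxx in vr.
have := last_stem v; rewrite E last_rcons => wv; rewrite wv -cats1 in E.
by exists (last root p); rewrite /child (stem_prefix E) E cats1.
Qed.

Lemma child_root a : ~~ child a root.
Proof. by rewrite /child stem_root; case: (stem a). Qed.

Lemma tree_ind_up (P : T -> Prop) : P root ->
  (forall a w, child a w -> P a -> P w) -> forall v, P v.
Proof.
move=> P0 Pc v; have [n] := ubnP (size (stem v)); elim: n v => // n IHn v.
have [->|vr] := eqVneq v root; first by [].
have [a av] := parent_ex vr; rewrite (eqP av) size_rcons ltnS => /IHn.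
exact: Pc.
Qed.

(** Well founded because stems have no repetitions, which bounds their length by the number of
    vertices. *)
Lemma tree_ind_down (P : T -> Prop) :
  (forall v, (forall w, child v w -> P w) -> P v) -> forall v, P v.
Proof.
move=> Pc v; have [n] := ubnP (#|T| - size (stem v)); elim: n v => // n IHn v.
rewrite ltnS => le_n; apply: Pc => w vw; apply: IHn; apply: leq_trans le_n.
rewrite (eqP vw) size_rcons ltn_sub2l //.
have /card_uniqP := uniq_stem w; rewrite (eqP vw) /= size_rcons => E.
have := max_card (mem (root :: stem w)).
by rewrite (eqP vw) E; apply: leq_trans.
Qed.

Lemma child_between u v x : child u v -> anc u x -> anc x v -> u != x -> x = v.
Proof.
move=> uv ux xv uNx; have [y uy yx] := anc_next ux uNx.
apply: (anc_anti xv).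
by rewrite (child_uniq uv uy (anc_refl v) (anc_trans yx xv)).
Qed.

Definition tmeet u v : T := last root (lcp (stem u) (stem v)).

Lemma stem_meet u v : stem (tmeet u v) = lcp (stem u) (stem v).
Proof.
by have [p [q [Ep _ _]]] := lcp_split (stem u) (stem v); exact: stem_prefix Ep.
Qed.

Lemma tmeetC u v : tmeet u v = tmeet v u.
Proof. by rewrite /tmeet lcpC. Qed.

Lemma anc_meet a u v : anc a (tmeet u v) = anc a u && anc a v.
Proof. by rewrite /anc stem_meet prefix_lcp. Qed.

Lemma tmeet_ancl u v : anc (tmeet u v) u.
Proof. by have := anc_refl (tmeet u v); rewrite anc_meet => /andP[]. Qed.

Lemma tmeet_ancr u v : anc (tmeet u v) v.
Proof. by rewrite tmeetC tmeet_ancl. Qed.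

Lemma tmeet_id v : tmeet v v = v.
Proof.
by apply: anc_anti; rewrite ?tmeet_ancl // anc_meet anc_refl.
Qed.

Lemma tmeet_anc a v : anc a v -> tmeet a v = a.
Proof.
by move=> av; apply: anc_anti; rewrite ?tmeet_ancl // anc_meet anc_refl.
Qed.

Section Heights.
Variable R : realType.
Implicit Types (l : {ffun {set T} -> R^o}).

Lemma gdist_root l : gdist G l root root = 0.
Proof. by rewrite /gdist geodxx. Qed.

Lemma gdist_child l a w :
  child a w -> gdist G l root w = gdist G l root a + l [set a; w].
Proof.
move=> /eqP E; rewrite /gdist -!/(stem _) E -cats1 plen_cat /= addr0.
by rewrite last_stem.
Qed.

(* The geodesic from u to v goes down to the last common vertex of the stems
   of u and v, and then up. *)
Lemma gdist_meet l u v : gdist G l u v =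
  gdist G l root u + gdist G l root v - 2 * gdist G l root (tmeet u v).
Proof.
have [p [q [Ep Eq dpq]]] := lcp_split (stem u) (stem v).
have Em := stem_meet u v; rewrite -Em in Ep Eq.
set m := tmeet u v in Em Ep Eq.
have lm : last root (stem m) = m by apply: last_stem.
have [pp qp] := (path_stem u, path_stem v).
rewrite Ep Eq !cat_path lm in pp qp; case/andP: pp => _ pp; case/andP: qp => _ qp.
have [up uq] := (uniq_stem u, uniq_stem v).
rewrite Ep Eq -!cat_cons !lastI lm -/m !cat_rcons !cat_uniq in up uq.
case/and3P: up => _ _ up; case/and3P: uq => _ _ uq.
have pl : last m p = u by have := last_stem u; rewrite Ep last_cat lm.
have ql : last m q = v by have := last_stem v; rewrite Eq last_cat lm.
have Eg : geod G u v = rev (belast m p) ++ q.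
  apply: geod_uniq.
  - rewrite cat_path -{1}pl rev_path.
    rewrite (eq_path (e' := G)); last by move=> x y; rewrite /= gadj_sym.
    by rewrite pp /= -{1}pl last_rev_belast.
  - have -> : u :: rev (belast m p) ++ q = rev (m :: p) ++ q.
      by rewrite [m :: p]lastI rev_rcons pl.
    have /= /andP[mq uq'] := uq.
    rewrite cat_uniq rev_uniq up uq' andbT andTb.
    apply/hasPn => x xq; rewrite /= mem_rev inE negb_or.
    apply/andP; split; first by apply: contraTneq xq => ->.
    apply/negP => xp; have xu : anc x u by rewrite ancE Ep inE mem_cat xp !orbT.
    have xv : anc x v by rewrite ancE Eq inE mem_cat xq !orbT.
    have : anc x m by rewrite anc_meet xu.
    rewrite ancE => xm; have := uniq_stem v.
    by rewrite Eq -cat_cons cat_uniq => /and3P[_ /hasPn/(_ x xq)/=]; rewrite xm.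
  - by rewrite last_cat -{1}pl last_rev_belast.
rewrite /gdist Eg -!/(stem _) Ep Eq !plen_cat lm.
by rewrite -{1 2}pl last_rev_belast plen_rev; ring.
Qed.

Lemma gdist_anc l a v : anc a v ->
  gdist G l root v = gdist G l root a + gdist G l a v.
Proof. by move=> av; rewrite (gdist_meet l a v) tmeet_anc //; ring. Qed.

Lemma gdist_ge0 l u v : (forall e, e \in edges G -> 0 <= l e) ->
  0 <= gdist G l u v.
Proof.
move=> l0; rewrite /gdist; have [+ _ _] := geodP u v.
move: (geod G u v) => p; elim: p u => //= w p IHp u /andP[uw /IHp].
by apply: addr_ge0; apply: l0; rewrite edgesE.
Qed.

Lemma gdist_gt0 l u v : (forall e, e \in edges G -> 0 < l e) -> u != v ->
  0 < gdist G l u v.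
Proof.
move=> l0 uNv; have ge0 w : 0 <= gdist G l w v.
  by apply: gdist_ge0 => e /l0/ltW.
have [gp gu gl] := geodP u v; rewrite /gdist.
case E : (geod G u v) gp gu gl => [|w p] /=.
  by move=> _ _ uv; case/eqP: uNv.
move=> /andP[uw wp] /andP[_ up] wv; have := ge0 w.
rewrite /gdist (geod_uniq wp up wv) => p0.
by rewrite ltr_pwDl // l0 // edgesE.
Qed.

(** Lengths are functions of sets: the symmetric double sum yields the height difference of the two
    ends of an edge without ordering them, and the half corrects for counting each pair twice. *)
Definition spread (g : T -> R) : {ffun {set T} -> R^o} :=
  [ffun e : {set T} => (\sum_(x in e) \sum_(y in e) `|g x - g y|) / 2].

Lemma spread2 g u v : u != v -> spread g [set u; v] = `|g u - g v|.
Proof.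
move=> uv; rewrite ffunE !(big_setU1, big_set1) ?inE //=.
by rewrite !subrr normr0 (distrC (g v)); lra.
Qed.

Lemma spread_height g : g root = 0 -> (forall u v, child u v -> g u <= g v) ->
  forall v, gdist G (spread g) root v = g v.
Proof.
move=> g0 gm; apply: tree_ind_up => [|a w aw Ha]; first by rewrite g0 gdist_root.
rewrite (gdist_child _ aw) Ha spread2 ?(gadj_neq (child_adj aw)) //.
by rewrite distrC ger0_norm ?subr_ge0 ?gm //; ring.
Qed.

End Heights.
End RootedTree.

(** * The Gromov products of the marks of a curve *)

Section CurveTree.
Variables (R : realType) (I : finType) (C : curve R I).
Implicit Types (i j k : I) (v w : vert C).

Local Notation anc := (anc (tree C) (vroot C)).
Local Notation child := (child (tree C) (vroot C)).
Let tC := treeP C.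

Definition mk i : vert C := mark C (Some i).

Definition cmeet i j : vert C := tmeet (tree C) (vroot C) (mk i) (mk j).

Definition delta i j : R := radius (cmeet i j).

Lemma anc_cmeet v i j : anc v (cmeet i j) = anc v (mk i) && anc v (mk j).
Proof. exact: anc_meet (vroot C) tC _ _ _. Qed.

Lemma beyondE v i : (i \in beyond v) = anc v (mk i).
Proof. by rewrite inE (ancE _ tC). Qed.

Lemma radius_root : radius (vroot C) = 0.
Proof. by rewrite /radius gdist_root. Qed.

Lemma radius_ge0 v : 0 <= radius v.
Proof. by apply: (gdist_ge0 tC) => e /len_gt0/ltW. Qed.

Lemma radius_anc v w : anc v w -> radius v <= radius w.
Proof.
move=> vw; rewrite /radius (gdist_anc tC _ vw) lerDl.
by apply: (gdist_ge0 tC) => e /len_gt0/ltW.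
Qed.

Lemma radius_anc_lt v w : anc v w -> v != w -> radius v < radius w.
Proof.
move=> vw vNw; rewrite /radius (gdist_anc tC _ vw) ltrDl.
by apply: (gdist_gt0 tC) => // e /len_gt0.
Qed.

(** Lengths are positive, so the radius orders the ancestors of one vertex; this turns inequalities
    between radii into ancestor relations. *)
Lemma anc_radius v w x : anc v x -> anc w x -> radius v <= radius w -> anc v w.
Proof.
move=> vx wx le_vw; case/orP: (anc_total vx wx) => // wv.
have [->|wNv] := eqVneq w v; first exact: anc_refl.
by have := radius_anc_lt wv wNv; rewrite ltNge le_vw.
Qed.

Lemma anc_radius_eq v w x : anc v x -> anc w x -> radius v = radius w -> v = w.
Proof.
move=> vx wx E; apply: (anc_anti tC).
  by apply: anc_radius vx wx _; rewrite E.
by apply: anc_radius wx vx _; rewrite E.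
Qed.

Lemma radius_eq0 v : (radius v == 0) = (v == vroot C).
Proof.
apply/eqP/eqP => [v0|->]; last exact: radius_root.
apply: (anc_radius_eq (x := v)); rewrite ?anc_refl ?(anc_root _ tC) //.
by rewrite v0 radius_root.
Qed.

Definition branches v : {set vert C + I} :=
  [set x | match x with inl w => child v w | inr i => mk i == v end].

Lemma card_marks v :
  #|[set i | mark C i == v]| = ((v == vroot C) + #|ends v|)%N.
Proof.
rewrite (cardsD1 None) inE eq_sym; congr (_ + _)%N.
rewrite -(card_imset _ (@Some_inj _ : injective (@Some I))); apply: eq_card.
case=> [i|]; rewrite !inE //=; last by apply/esym/imsetP => -[].
by rewrite mem_imset ?inE //; apply: Some_inj.
Qed.

(** One of the three units of valence points towards the root: the edge to the parent or, at the
    root itself, end 1. The others are branches. *)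
Lemma branches_gt1 v : (1 < #|branches v|)%N.
Proof.
pose A := [set w | child v w]; pose B := ends v.
have cardS : (#|A| + #|B| <= #|branches v|)%N.
  rewrite -(card_imset _ (@inl_inj (vert C) I)) -(card_imset B (@inr_inj (vert C) I)).
  rewrite -cardsUI (_ : (_ :&: _)%SET = set0) ?cards0 ?addn0.
    apply/subset_leq_card/subsetP => x /setUP[] /imsetP[y].
      by rewrite inE => ? ->; rewrite inE.
    by rewrite inE => ? ->; rewrite inE.
  apply/setP => x; rewrite !inE; apply/negP => /andP[/imsetP[y _ ->]].
  by case/imsetP.
apply: leq_trans cardS; have := valence_ge3 v; rewrite card_marks addnA.
rewrite -[(2 < _)%N]/(1 + 2 <= _)%N => val3.
rewrite -(leq_add2l 1%N); apply: leq_trans val3 _; rewrite addnA leq_add2r.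
have [vr|vNr] := eqVneq v (vroot C).
  rewrite addnC leq_add2l; apply/subset_leq_card/subsetP => w.
  rewrite !inE => /(adj_child (vroot C) tC).
  by case/orP => //; rewrite vr (negPf (child_root _ tC _)).
have [a av] := parent_ex tC vNr.
rewrite addn0 -(cards1 a); apply: leq_trans (leq_card_setU _ _).
apply/subset_leq_card/subsetP => w; rewrite !inE.
move=> /(adj_child (vroot C) tC)/orP[->|wv]; first by rewrite orbT.
by rewrite (parent_uniq tC av wv) eqxx.
Qed.

Lemma beyond_ex v : exists i, anc v (mk i).
Proof.
move: v; apply: (tree_ind_down (root := vroot C) tC) => v IH.
have /card_gt0P[[w|i]] : (0 < #|branches v|)%N by apply: ltnW (branches_gt1 v).
  by rewrite inE => vw; have [i wi] := IH w vw; exists i;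
    apply: anc_trans wi; apply: child_anc vw.
by rewrite inE => /eqP <-; exists i; apply: anc_refl.
Qed.

(* A vertex of valence at least 3 has two branches leading away from the root. *)
Lemma vertex_cmeet v : exists i j, i != j /\ cmeet i j = v.
Proof.
have /card_gt1P[x [y [xS yS xNy]]] := branches_gt1 v.
pose rep (x : vert C + I) i := match x with inl w => anc w (mk i) | inr i' => i' == i end.
have repP x0 : exists i, rep x0 i.
  by case: x0 => [w|i]; [apply: beyond_ex|exists i => /=].
have rep_anc x0 i : x0 \in branches v -> rep x0 i -> anc v (mk i).
  rewrite inE; case: x0 => [w /child_anc vw|i' /eqP vi /eqP <-].
    exact: anc_trans.
  by rewrite vi anc_refl.
have rep_child x0 i w : x0 \in branches v -> rep x0 i -> child v w ->
    anc w (mk i) -> x0 = inl w.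
  rewrite inE; case: x0 => [w' vw' wi vw w'i|i' /eqP vi /eqP <- vw].
    by rewrite (child_uniq vw vw' w'i wi).
  by rewrite vi (negPf (child_Nanc tC vw)).
have [i xi] := repP x; have [j yj] := repP y.
have vij : anc v (cmeet i j).
  by rewrite anc_cmeet (rep_anc _ _ xS xi) (rep_anc _ _ yS yj).
have mv : cmeet i j = v.
  apply/eqP; rewrite eq_sym; apply: contraTT isT => vNm.
  have [w vw] := anc_next tC vij vNm; rewrite anc_cmeet => /andP[wi wj].
  by rewrite (rep_child _ _ _ xS xi vw wi) (rep_child _ _ _ yS yj vw wj) eqxx in xNy.
exists i, j; split=> //; apply: contraNneq xNy => ij; move: mv; subst j.
rewrite /cmeet (tmeet_id _ tC) => iv; move: xS yS xi yj; rewrite !inE.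
case: x => [w vw _ /= wi _|i1 _]; first by case/negP: (child_Nanc tC vw); rewrite -iv.
case: y => [w vw _ /= wi|i2 _ /=]; first by case/negP: (child_Nanc tC vw); rewrite -iv.
by move=> /eqP -> /eqP ->.
Qed.

Lemma deltaC i j : delta i j = delta j i.
Proof. by rewrite /delta /cmeet tmeetC. Qed.

Lemma delta_ge0 i j : 0 <= delta i j.
Proof. exact: radius_ge0. Qed.

(** [cmeet i j] and [cmeet j k] both lie on the stem of [mk j], hence are comparable, and the one
    nearer the root is an ancestor of both [mk i] and [mk k]. *)
Lemma delta_ultra r i j k : r <= delta i j -> r <= delta j k -> r <= delta i k.
Proof.
rewrite /delta => rij rjk.
have [ai aj] : anc (cmeet i j) (mk i) /\ anc (cmeet i j) (mk j).
  by apply/andP; rewrite -anc_cmeet anc_refl.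
have [bj bk] : anc (cmeet j k) (mk j) /\ anc (cmeet j k) (mk k).
  by apply/andP; rewrite -anc_cmeet anc_refl.
case/orP: (anc_total aj bj) => [ab|ba].
  by apply: le_trans rij (radius_anc _); rewrite anc_cmeet ai (anc_trans ab).
by apply: le_trans rjk (radius_anc _); rewrite anc_cmeet bk (anc_trans ba).
Qed.

Lemma delta0_ex : exists i j, i != j /\ delta i j = 0.
Proof.
have [i [j [ij m]]] := vertex_cmeet (vroot C).
by exists i, j; rewrite /delta m radius_root.
Qed.

Lemma delta_diag i : delta i i = radius (mk i).
Proof. by rewrite /delta /cmeet (tmeet_id _ tC). Qed.

Lemma delta_le_diag i j : delta i j <= delta i i.
Proof. by rewrite delta_diag radius_anc // /cmeet (tmeet_ancl _ tC). Qed.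

(** Two distinct ends meet at the vertex of [i], and one of them is not [i]. Together with
    [delta_le_diag] this recovers the diagonal from the other values. *)
Lemma delta_diag_ex i : exists2 j, i != j & delta i j = delta i i.
Proof.
suff [j ij aj] : exists2 j, i != j & anc (mk i) (mk j).
  by exists j; rewrite // delta_diag /delta /cmeet (tmeet_anc tC).
have [j [k [jNk mjk]]] := vertex_cmeet (mk i).
have : anc (mk i) (cmeet j k) by rewrite mjk anc_refl.
rewrite anc_cmeet => /andP[aj ak].
have [ij|ij] := eqVneq i j; last by exists j.
by subst j; exists k.
Qed.

Lemma le_delta r i j : reflect (exists v, [/\ r <= radius v, anc v (mk i) & anc v (mk j)])
  (r <= delta i j).
Proof.
apply: (iffP idP) => [rij|[v [rv vi vj]]].
  have : anc (cmeet i j) (cmeet i j) by apply: anc_refl.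
  by rewrite anc_cmeet => /andP[ai aj]; exists (cmeet i j).
by apply: le_trans rv (radius_anc _); rewrite anc_cmeet vi.
Qed.

End CurveTree.
Arguments mk {R I} C i.
Arguments cmeet {R I} C i j.
Arguments delta {R I} C i j.

(** * Curves compared through their Gromov products *)

Section CurveCompare.
Variables (R : realType) (I : finType).
Implicit Types (C D : curve R I) (i j k h : I).

Local Notation ancC C := (anc (tree C) (vroot C)).
Local Notation childC C := (child (tree C) (vroot C)).
Local Notation meetC C := (tmeet (tree C) (vroot C)).
Local Notation height C l := (gdist (tree C) l (vroot C)).

(** Twice a Gromov product is the sum of the root distances of two marks minus their mutual
    distance, and the contraction preserves all three. *)
Lemma cone_point_delta C l D : cone_point (C := C) l D ->
  forall i j, delta D i j = height C l (cmeet C i j).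
Proof.
case=> _ _ [f [_ fm fd]] i j.
have := fd (mk C i) (mk C j); have := fd (vroot C) (mk C i).
have := fd (vroot C) (mk C j); rewrite /mk /vroot !fm -/(mk _ _) -/(vroot _).
rewrite (gdist_meet (vroot C) (treeP C) l (mk C i)).
rewrite (gdist_meet (vroot D) (treeP D) (len D) (mk D i)).
by rewrite /delta /radius /cmeet => -> ->; lra.
Qed.

Lemma rad_cone_delta C D i j k h : rad_cone C D ->
  delta C i j <= delta C k h -> delta D i j <= delta D k h.
Proof.
case=> l Dl; rewrite !(cone_point_delta Dl); case: Dl => _ mono _.
exact: mono.
Qed.

Definition compat C D := forall i j k h,
  delta C i j <= delta C k h -> delta D i j <= delta D k h.

(** Curves are constructed with prescribed products of distinct ends only. A diagonal value
    dominates its row and is attained off the diagonal, so diagonal entries can be replaced. *)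
Lemma compat_offdiag C D :
  (forall i j k h, i != j -> k != h ->
     delta C i j <= delta C k h -> delta D i j <= delta D k h) -> compat C D.
Proof.
move=> cmp i j k h le_C.
have [j' [ij' Ej le_Dj]] : exists j', [/\ i != j', delta C i j' <= delta C i j
    & delta D i j <= delta D i j'].
  have [ij|ij] := eqVneq i j; last by exists j.
  subst j; have [j' ij' E] := delta_diag_ex D i; exists j'.
  by rewrite E; split; rewrite ?delta_le_diag.
have [h' [kh' Eh le_Dh]] : exists h', [/\ k != h', delta C k h <= delta C k h'
    & delta D k h' <= delta D k h].
  have [kh|kh] := eqVneq k h; last by exists h.
  subst h; have [h' kh' E] := delta_diag_ex C k; exists h'.
  by rewrite E; split; rewrite ?delta_le_diag.
apply: le_trans le_Dj (le_trans _ le_Dh); apply: cmp => //.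
exact: le_trans Ej (le_trans le_C Eh).
Qed.

(** Whether an end lies beyond a meet is an inequality between two products with a common end, and
    [compat] transports it. *)
Lemma compat_anc C D k h i : compat C D ->
  ancC C (cmeet C k h) (mk C i) -> ancC D (cmeet D k h) (mk D i).
Proof.
move=> cmp vi; have : delta C k h <= delta C i k.
  apply: radius_anc; rewrite anc_cmeet vi.
  by have := anc_refl (tree C) (vroot C) (cmeet C k h); rewrite anc_cmeet => /andP[].
move=> /cmp le_D; have kD : ancC D (cmeet D k h) (mk D k).
  by have := anc_refl (tree D) (vroot D) (cmeet D k h); rewrite anc_cmeet => /andP[].
have : ancC D (cmeet D i k) (mk D i) && ancC D (cmeet D i k) (mk D k).
  by rewrite -anc_cmeet anc_refl.
case/andP=> iD kD'; apply: anc_trans iD.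
exact: anc_radius kD kD' le_D.
Qed.

Lemma compat_cmeet C D i j k h : compat C D ->
  cmeet C i j = cmeet C k h -> cmeet D i j = cmeet D k h.
Proof.
move=> cmp E; have Er : radius (cmeet D i j) = radius (cmeet D k h).
  by apply: le_anti; rewrite !cmp // /delta E.
have : ancC C (cmeet C i j) (cmeet C i j) by apply: anc_refl.
rewrite anc_cmeet {1}E => /andP[/(compat_anc cmp) iD _].
apply: anc_radius_eq iD Er.
by have := anc_refl (tree D) (vroot D) (cmeet D i j); rewrite anc_cmeet => /andP[].
Qed.

(** Every vertex is some [cmeet C i j], so the labels force the map; [compat_cmeet] makes it
    independent of the pair. *)
Lemma compat_map C D : compat C D ->
  exists f : vert C -> vert D, forall i j, f (cmeet C i j) = cmeet D i j.
Proof.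
move=> cmp; have ex v : exists ij : I * I, cmeet C ij.1 ij.2 == v.
  by have [i [j [_ E]]] := vertex_cmeet v; exists (i, j); apply/eqP.
exists (fun v => let ij := xchoose (ex v) in cmeet D ij.1 ij.2) => i j /=.
exact/(compat_cmeet cmp)/eqP/(xchooseP (ex (cmeet C i j))).
Qed.

Section CompatMap.
Variables (C D : curve R I) (f : vert C -> vert D).
Hypothesis cmp : compat C D.
Hypothesis fE : forall i j, f (cmeet C i j) = cmeet D i j.
Implicit Types u v w : vert C.

Lemma compat_map_mk i : f (mk C i) = mk D i.
Proof.
have E B : cmeet B i i = mk B i by rewrite /cmeet (tmeet_id _ (treeP B)).
by rewrite -!E fE.
Qed.

Lemma compat_map_beyond v i : ancC C v (mk C i) -> ancC D (f v) (mk D i).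
Proof. by have [k [h [_ <-]]] := vertex_cmeet v; rewrite fE; apply: compat_anc. Qed.

Lemma compat_map_radius u v : radius u <= radius v -> radius (f u) <= radius (f v).
Proof.
have [i [j [_ <-]]] := vertex_cmeet u; have [k [h [_ <-]]] := vertex_cmeet v.
by rewrite !fE; apply: cmp.
Qed.

Lemma compat_map_root : f (vroot C) = vroot D.
Proof.
apply/eqP; rewrite -radius_eq0 eq_le radius_ge0 andbT.
have [i [j [_ E]]] := vertex_cmeet (vroot C).
have [k [h [_ D0]]] := delta0_ex D; rewrite -D0 -E fE.
by apply: cmp; rewrite /delta E radius_root radius_ge0.
Qed.

Lemma compat_map_mark (i : option I) : f (mark C i) = mark D i.
Proof. by case: i => [i|]; [apply: compat_map_mk|apply: compat_map_root]. Qed.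

Lemma compat_map_surj (w : vert D) : exists v, f v = w.
Proof. by have [i [j [_ <-]]] := vertex_cmeet w; exists (cmeet C i j). Qed.

Lemma compat_map_anc u v : ancC C u v -> ancC D (f u) (f v).
Proof.
move=> uv; have [i vi] := beyond_ex v.
apply: (anc_radius (x := mk D i)); rewrite ?compat_map_beyond //.
  exact: anc_trans vi.
exact/compat_map_radius/radius_anc.
Qed.

(** The meet of incomparable vertices is the [cmeet] of any two ends beyond them, which the map
    respects by construction; for comparable ones the ancestor order suffices. *)
Lemma compat_map_meet u v : f (meetC C u v) = meetC D (f u) (f v).
Proof.
have [uv|uNv] := boolP (ancC C u v).
  by rewrite (tmeet_anc (treeP C) uv) (tmeet_anc (treeP D)) // compat_map_anc.
have [vu|vNu] := boolP (ancC C v u).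
  rewrite tmeetC (tmeet_anc (treeP C) vu) tmeetC.
  by rewrite (tmeet_anc (treeP D)) // compat_map_anc.
have [i ui] := beyond_ex u; have [j vj] := beyond_ex v.
have : ancC C (cmeet C i j) (cmeet C i j) by apply: anc_refl.
rewrite anc_cmeet => /andP[mi mj].
have mu : ancC C (cmeet C i j) u.
  case/orP: (anc_total mi ui) => // um.
  have := anc_total (anc_trans um mj) vj.
  by rewrite (negPf uNv) (negPf vNu).
have mv : ancC C (cmeet C i j) v.
  case/orP: (anc_total mj vj) => // vm.
  have := anc_total (anc_trans vm mi) ui.
  by rewrite (negPf uNv) (negPf vNu).
have -> : meetC C u v = cmeet C i j.
  apply: (anc_anti (root := vroot C) (treeP C)); last first.
    by rewrite (anc_meet _ (treeP C)) mu.
  rewrite anc_cmeet (anc_trans (tmeet_ancl _ (treeP C) _ _) ui).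
  exact: anc_trans (tmeet_ancr _ (treeP C) _ _) vj.
apply: (anc_anti (root := vroot D) (treeP D)).
  by rewrite (anc_meet _ (treeP D)) !compat_map_anc.
rewrite fE anc_cmeet (anc_trans (tmeet_ancl _ (treeP D) _ _)) ?compat_map_beyond //.
by rewrite (anc_trans (tmeet_ancr _ (treeP D) _ _)) ?compat_map_beyond.
Qed.

(** The lengths give each vertex the height of its image, so an edge whose two ends have the same
    image gets length 0. *)
Lemma compat_cone_point :
  cone_point (C := C) (spread (fun v => radius (f v))) D.
Proof.
pose g v := radius (f v).
have hE : forall v, height C (spread g) v = g v.
  apply: (spread_height (root := vroot C) (treeP C)) => [|u v uv].
    by rewrite /g compat_map_root radius_root.
  exact/radius_anc/compat_map_anc/child_anc.
split=> [e /edgesP[u [v [uv ->]]]|u v uv|].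
- by rewrite spread2 ?(gadj_neq uv) // normr_ge0.
- by rewrite !hE; apply: compat_map_radius.
exists f; split=> [|i|u v]; [exact: compat_map_surj|exact: compat_map_mark|].
rewrite (gdist_meet (vroot C) (treeP C)) (gdist_meet (vroot D) (treeP D)).
by rewrite !hE /g compat_map_meet.
Qed.

End CompatMap.

Lemma compat_rad_cone C D : compat C D -> rad_cone C D.
Proof.
move=> cmp; have [f fE] := compat_map cmp.
by exists (spread (fun v => radius (f v))); apply: compat_cone_point.
Qed.

Lemma rad_coneP C D : rad_cone C D <-> compat C D.
Proof.
split=> [CD i j k h|]; first exact: rad_cone_delta.
exact: compat_rad_cone.
Qed.

Lemma curve_iso_delta C D : curve_iso C D -> forall i j, delta C i j = delta D i j.
Proof.
case=> f [[g gf fg] fG fm fl] i j; rewrite [RHS](@cone_point_delta C (len C)) //.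
split=> [e /len_gt0/ltW|u v|] //; exists f; split=> // [w|u v].
  by exists (g w); rewrite fg.
have [gp gu gl] := geodP (treeP C) u v; rewrite /gdist.
rewrite (geod_uniq (treeP D) (u := f u) (p := map f (geod (tree C) u v))).
- move: gp; move: (geod _ _ _) => p; elim: p u {gu gl} => //= w p IHp u.
  move=> /andP[uw wp]; rewrite IHp //; congr (_ + _).
  by rewrite -fl ?edgesE // imsetU1 imset_set1.
- by rewrite path_map (eq_path (e' := tree C)).
- by rewrite -map_cons map_inj_uniq //; apply: can_inj gf.
- by rewrite last_map gl.
Qed.

Lemma delta_curve_iso C D :
  (forall i j, delta C i j = delta D i j) -> curve_iso C D.
Proof.
move=> E; have cCD : compat C D by move=> i j k h; rewrite !E.
have cDC : compat D C by move=> i j k h; rewrite !E.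
have [f fE] := compat_map cCD; have [g gE] := compat_map cDC.
have gf : cancel f g.
  by move=> v; have [i [j [_ <-]]] := vertex_cmeet v; rewrite fE gE.
have fg : cancel g f.
  by move=> v; have [i [j [_ <-]]] := vertex_cmeet v; rewrite gE fE.
(* An edge is a covering pair of the ancestor order, and two inverse maps preserving this order
   preserve its covering pairs. *)
have child_map A B (p : vert A -> vert B) (q : vert B -> vert A) u v :
    compat A B -> compat B A -> (forall i j, p (cmeet A i j) = cmeet B i j) ->
    (forall i j, q (cmeet B i j) = cmeet A i j) -> cancel p q -> cancel q p ->
    childC A u v -> childC B (p u) (p v).
  move=> cAB cBA pE qE pq qp uv.
  have puNpv : p u != p v.
    by rewrite (can_eq pq) (gadj_neq (child_adj (treeP A) uv)).
  have [w puw wpv] := anc_next (treeP B)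
    (compat_map_anc cAB pE (child_anc uv)) puNpv.
  have := compat_map_anc cBA qE (child_anc puw); rewrite pq => uqw.
  have := compat_map_anc cBA qE wpv; rewrite pq => qwv.
  rewrite -(child_between (treeP A) uv uqw qwv) ?qp //.
  by apply: contraNneq (gadj_neq (child_adj (treeP B) puw)) => ->; rewrite qp.
have rE v : radius (f v) = radius v.
  by have [i [j [_ <-]]] := vertex_cmeet v; rewrite fE -!/(delta _ _ _) E.
have adjE u v : tree D (f u) (f v) = tree C u v.
  apply/idP/idP => [|uv].
    case/(adj_child (vroot D) (treeP D))/orP.
      by move/(child_map _ _ g f _ _ cDC cCD gE fE fg gf); rewrite !gf => /(child_adj (treeP _))->.
    move/(child_map _ _ g f _ _ cDC cCD gE fE fg gf); rewrite !gf gadj_sym.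
    by move/(child_adj (treeP _))->.
  case/orP: (adj_child (vroot C) (treeP C) uv).
    by move/(child_map _ _ f g _ _ cCD cDC fE gE gf fg)/(child_adj (treeP _))->.
  rewrite gadj_sym.
  by move/(child_map _ _ f g _ _ cCD cDC fE gE gf fg)/(child_adj (treeP _))->.
exists f; split=> //; [by exists g|exact: compat_map_mark cCD fE|].
have len_child u v : childC C u v -> len D (f @: [set u; v]) = len C [set u; v].
  move=> uv; have fuv := child_map _ _ f g _ _ cCD cDC fE gE gf fg uv.
  have := gdist_child (treeP D) (len D) fuv.
  have := gdist_child (treeP C) (len C) uv.
  rewrite -!/(radius _) !rE imsetU1 imset_set1 => -> /eqP.
  by rewrite (inj_eq (addrI _)) => /eqP.
move=> e /edgesP[u [v [uv ->]]].
case/orP: (adj_child (vroot C) (treeP C) uv); first exact: len_child.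
by move/len_child; rewrite setUC.
Qed.

Definition gst (G : sgraph I) C := forall v, v != vroot C ->
  exists u w, [/\ G u w, ancC C v (mk C u) & ancC C v (mk C w)].

(** By the valence bound, stability can fail only at a non-root vertex with one bounded edge. Every
    non-root vertex has such a childless vertex at or beyond it, and an edge of [G] found there
    serves for both. *)
Lemma gstableP G C : gstable G C <-> gst G C.
Proof.
have tC := treeP C; split=> [st|st v].
  apply: (tree_ind_down (root := vroot C) tC) => v IH vNr.
  have [[w vw]|nch] := pselect (exists w, childC C v w).
    have wNr : w != vroot C.
      by apply: contraTneq vw => ->; rewrite (child_root _ tC).
    have [a [b [ab wa wb]]] := IH w vw wNr; exists a, b.
    by split=> //; [apply: anc_trans wa|apply: anc_trans wb]; apply: child_anc.
  have [a av] := parent_ex tC vNr.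
  have le1 : (bdeg v <= 1)%N.
    rewrite -(cards1 a); apply/subset_leq_card/subsetP => w; rewrite !inE.
    case/(adj_child (vroot C) tC)/orP => [vw|wv]; first by case: nch; exists w.
    by rewrite (parent_uniq tC av wv).
  have := st v; rewrite /gstable_at (negPf vNr) ltnNge (leq_trans le1) //=.
  case/orP => [/andP[/eqP E]|/andP[_ /exists_inP[i iv /exists_inP[j jv ij]]]].
    by rewrite E in le1.
  exists i, j; move: iv jv; rewrite !inE => /eqP iv /eqP jv.
  by rewrite /mk iv jv anc_refl.
have := valence_ge3 v; rewrite /gstable_at card_marks -/(bdeg v).
have [vr|vNr] := eqVneq v (vroot C).
  rewrite -card_gt0; case: (bdeg v) => [|[|b]] //=; by case: #|ends v|.
rewrite -card_gt0 add0n => val.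
have [a av] := parent_ex tC vNr.
have b0 : (0 < bdeg v)%N.
  by apply/card_gt0P; exists a; rewrite inE gadj_sym (child_adj tC av).
have [b1|bn1] := eqVneq (bdeg v) 1%N; last first.
  by case: (bdeg v) b0 bn1 val => [|[|[|b]]] //= _ _; case: #|ends v|.
rewrite b1 /=; have [i [j [ij vi vj]]] := st v vNr.
have end_v k : ancC C v (mk C k) -> k \in ends v.
  move=> vk; rewrite inE eq_sym; apply: contraTT isT => vNk.
  have [w vw _] := anc_next tC vk vNk.
  have : (1 < bdeg v)%N; last by rewrite b1.
  apply/card_gt1P; exists a, w; rewrite !inE gadj_sym (child_adj tC av).
  rewrite (child_adj tC vw); split=> //; apply: contraTneq vw => <-.
  by apply: contraTN isT => /child_anc va; case/negP: (child_Nanc tC av).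
by apply/exists_inP; exists i; [exact: end_v|apply/exists_inP; exists j; [exact: end_v|]].
Qed.

(** Non-root vertices are the meets of positive radius, and an end lies beyond [cmeet C i j] exactly
    when its product with [i] is at least [delta C i j]. *)
Lemma gst_delta G C : gst G C <-> forall i j, i != j -> 0 < delta C i j ->
  exists u w, [/\ G u w, delta C i j <= delta C i u & delta C i j <= delta C i w].
Proof.
split=> [st i j ij d0|st v vNr].
  have mNr : cmeet C i j != vroot C by rewrite -radius_eq0 gt_eqF.
  have : ancC C (cmeet C i j) (cmeet C i j) by apply: anc_refl.
  rewrite anc_cmeet => /andP[mi _].
  have [u [w [uw mu mw]]] := st _ mNr; exists u, w.
  by split=> //; apply/le_delta; exists (cmeet C i j).
have [i [j [ij mv]]] := vertex_cmeet v.
have : ancC C v (cmeet C i j) by rewrite mv anc_refl.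
rewrite anc_cmeet => /andP[vi _].
have [|u [w [uw iu iw]]] := st i j ij.
  by rewrite /delta mv lt_neqAle eq_sym radius_eq0 vNr radius_ge0.
exists u, w; split=> //.
  have : ancC C (cmeet C i u) (cmeet C i u) by apply: anc_refl.
  rewrite anc_cmeet => /andP[ci cu]; apply: anc_trans cu.
  by apply: anc_radius vi ci _; rewrite -mv.
have : ancC C (cmeet C i w) (cmeet C i w) by apply: anc_refl.
rewrite anc_cmeet => /andP[ci cu]; apply: anc_trans cu.
by apply: anc_radius vi ci _; rewrite -mv.
Qed.

End CurveCompare.

(** * Reconstruction of a curve from its Gromov products *)

(* The curve with prescribed Gromov products [d i j] of its marks: its vertices
   are the balls of the ultrametric [1 / d]. *)
Section CurveOfUltrametric.
Variables (R : realType) (I : finType) (d : I -> I -> R).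
Hypothesis dC : forall i j, d i j = d j i.
Hypothesis d_ultra : forall r i j k, i != k -> r <= d i j -> r <= d j k ->
  i != j -> j != k -> r <= d i k.
Hypothesis d_ge0 : forall i j, 0 <= d i j.
Hypothesis d0_ex : exists i j, i != j /\ d i j = 0.
Implicit Types (i j k : I) (A B X Y : {set I}).

(** The centre is added by hand, since the ultrametric hypothesis does not constrain the diagonal of
    [d]. *)
Definition ball i (r : R) : {set I} := [set k | (k == i) || (r <= d i k)].

(** The radius has to be the product of two distinct labels: both lie in the ball, so its depth is
    determined by the set and its vertex has two branches. *)
Definition is_ball A : bool :=
  [exists i, exists j, (i != j) && (A == ball i (d i j))].

(** For a ball this is the smallest product of two distinct elements; 0 is the default for other
    sets. *)
Definition depth A : R :=
  xget 0 [set r | exists i j, [/\ i != j, A = ball i (d i j) & r = d i j]]%classic.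

Lemma ball_pair i j k l : i != j -> k \in ball i (d i j) -> l \in ball i (d i j) ->
  k != l -> d i j <= d k l.
Proof.
move=> ij; rewrite !inE => /orP[/eqP ->|ik] /orP[/eqP ->|il].
- by rewrite eqxx.
- by [].
- by rewrite (dC k).
- move=> kl; have [ki|ki] := eqVneq k i; first by rewrite ki.
  have [li|li] := eqVneq l i; first by rewrite li (dC k).
  by apply: (@d_ultra _ k i l); rewrite // 1?(dC k) // eq_sym.
Qed.

Lemma depthE i j : i != j -> depth (ball i (d i j)) = d i j.
Proof.
move=> ij; rewrite /depth; case: xgetP => [r _ [k [l [kl E ->]]]|/(_ (d i j)) []].
  have ii : i \in ball i (d i j) by rewrite inE eqxx.
  have ji : j \in ball i (d i j) by rewrite inE lexx orbT.
  have kk : k \in ball k (d k l) by rewrite inE eqxx.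
  have lk : l \in ball k (d k l) by rewrite inE lexx orbT.
  apply: le_anti; apply/andP; split; first by apply: (ball_pair kl); rewrite -?E.
  by apply: (ball_pair ij); rewrite ?E.
by exists i, j.
Qed.

Lemma is_ballP A : is_ball A -> exists i j, [/\ i != j, i \in A, j \in A,
  depth A = d i j & A = ball i (d i j)].
Proof.
case/existsP=> i /existsP[j /andP[ij /eqP ->]]; exists i, j.
by split; rewrite ?depthE // inE ?eqxx ?lexx ?orbT.
Qed.

Lemma is_ball_ball i j : i != j -> is_ball (ball i (d i j)).
Proof. by move=> ij; apply/existsP; exists i; apply/existsP; exists j; rewrite ij eqxx. Qed.

Lemma depth_le A k l : is_ball A -> k \in A -> l \in A -> k != l -> depth A <= d k l.
Proof. by case/is_ballP=> i [j [ij _ _ -> ->]]; apply: ball_pair. Qed.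

Lemma depth_in A k l : is_ball A -> k \in A -> depth A <= d k l -> l \in A.
Proof.
case/is_ballP=> i [j [ij _ _ -> ->]]; rewrite !inE => /orP[/eqP ->|ik kl].
  by move=> ->; rewrite orbT.
have [->//|li] := eqVneq l i; have [ki|ki] := eqVneq k i; first by rewrite ki in kl.
have [<-//|kNl] := eqVneq k l.
by rewrite (@d_ultra _ i k l) // 1?eq_sym.
Qed.

Lemma ball_sub A B k : is_ball A -> is_ball B -> k \in A -> k \in B ->
  depth A <= depth B -> B \subset A.
Proof.
move=> bA bB kA kB AB; apply/subsetP => l lB.
have [<-//|kl] := eqVneq k l; apply: (depth_in bA kA).
exact: le_trans AB (depth_le bB kB lB kl).
Qed.

Lemma ball_laminar A B k : is_ball A -> is_ball B -> k \in A -> k \in B ->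
  (A \subset B) || (B \subset A).
Proof.
move=> bA bB kA kB; case: (leP (depth A) (depth B)) => [AB|/ltW BA].
  by rewrite (ball_sub bA bB kA kB AB) orbT.
by rewrite (ball_sub bB bA kB kA BA).
Qed.

Lemma depth_anti A B : is_ball A -> is_ball B -> A \subset B -> depth B <= depth A.
Proof.
move=> bA bB /subsetP AB; have [i [j [ij iA jA -> _]]] := is_ballP bA.
by apply: depth_le; rewrite ?AB.
Qed.

Lemma depth_proper A B : is_ball A -> is_ball B -> A \proper B -> depth B < depth A.
Proof.
move=> bA bB /andP[AB BA]; rewrite lt_neqAle depth_anti // andbT.
apply: contraNneq BA => E; have [i [_ [_ iA _ _ _]]] := is_ballP bA.
by apply: (ball_sub bA bB iA); rewrite ?E // (subsetP AB).
Qed.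

Definition bvert := {A : {set I} | is_ball A}.
Implicit Types (u v w x : bvert).

Lemma is_ballT : is_ball setT /\ depth setT = 0.
Proof.
have [i [j [ij d0]]] := d0_ex; suff -> : setT = ball i (d i j).
  by rewrite is_ball_ball // depthE.
by apply/setP => k; rewrite !inE d0 d_ge0 orbT.
Qed.

Definition btop : bvert := exist _ setT (proj1 is_ballT).

(** The Hasse diagram of the balls under inclusion: [v] is the child and [w] the least ball strictly
    above it. *)
Definition bpar v w : bool := (val v \proper val w) &&
  [forall x : bvert, (val v \proper val x) ==> (val w \subset val x)].

Lemma bpar_proper v w : bpar v w -> val v \proper val w.
Proof. by case/andP. Qed.

Lemma bpar_min v w x : bpar v w -> val v \proper val x -> val w \subset val x.
Proof. by case/andP=> _ /forallP/(_ x)/implyP; apply. Qed.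

Lemma bpar_uniq v w x : bpar v w -> bpar v x -> w = x.
Proof.
move=> vw vx; apply/val_inj/eqP; rewrite eqEsubset.
by rewrite (bpar_min vw (bpar_proper vx)) (bpar_min vx (bpar_proper vw)).
Qed.

Lemma bvert_ex v : exists i, i \in val v.
Proof. by have [i [_ [_ iv _ _ _]]] := is_ballP (valP v); exists i. Qed.

Lemma bpar_ex v : v != btop -> exists w, bpar v w.
Proof.
move=> vT; have ex : exists n, [exists x : bvert, (val v \proper val x) && (#|val x| == n)].
  exists #|setT : {set I}|; apply/existsP; exists btop; rewrite eqxx andbT.
  by rewrite properT; apply: contraNneq vT => E; apply/eqP/val_inj.
case: (ex_minnP ex) => n /existsP[w /andP[vw /eqP wn]] minw; exists w.
apply/andP; split=> //; apply/forallP => x; apply/implyP => vx.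
have [i iv] := bvert_ex v; have [vsw vsx] := (proper_sub vw, proper_sub vx).
have := ball_laminar (valP w) (valP x) (subsetP vsw _ iv) (subsetP vsx _ iv).
case/orP=> // xw; have /eqP -> // : val x == val w.
by rewrite eqEcard xw wn minw //; apply/existsP; exists x; rewrite vx eqxx.
Qed.

Lemma bchild_ex w x i : val x \proper val w -> i \in val x ->
  exists v, bpar v w /\ i \in val v.
Proof.
move=> xw ix.
pose P v := (val v \proper val w) && (i \in val v).
have Px : P x by rewrite /P xw.
case: (@arg_maxnP _ x P (fun v : bvert => #|val v|) Px) => v /andP[vw iv] maxv.
exists v; split=> //; apply/andP; split=> //; apply/forallP => y; apply/implyP => vy.
have [vsw vsy] := (proper_sub vw, proper_sub vy).
case/orP: (ball_laminar (valP w) (valP y) (subsetP vsw _ iv) (subsetP vsy _ iv)) => // yw.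
apply: contraTT (proper_card vy) => wNy; rewrite -leqNgt; apply: maxv.
by rewrite /P properE yw wNy (subsetP vsy).
Qed.

Definition badj v w := bpar v w || bpar w v.

Lemma badj_sym : symmetric badj.
Proof. by move=> v w; rewrite /badj orbC. Qed.

Lemma badj_irr : irreflexive badj.
Proof. by move=> v; rewrite /badj orbb; apply/negP => /bpar_proper; rewrite properxx. Qed.

Definition btree := SGraph badj_sym badj_irr.

Lemma btreeP : is_tree btree.
Proof.
have csym : connect_sym btree by apply/sym_connect_sym/gadj_sym.
have ctop v : connect btree v btop.
  have [n] := ubnP (#|setT : {set I}| - #|val v|); elim: n v => // n IHn v le_n.
  have [->|/bpar_ex[w vw]] := eqVneq v btop; first exact: connect0.
  apply: connect_trans (connect1 _) (IHn w _); first by rewrite /= /badj vw.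
  apply: leq_trans (le_n : (_ <= n)%N); rewrite ltn_sub2l //.
    apply: leq_trans (proper_card (bpar_proper vw)) _.
    exact/subset_leq_card/subsetT.
  exact/proper_card/bpar_proper.
split=> [v w|]; first by apply: connect_trans (ctop v) _; rewrite csym.
apply/acyclicP => u v _; rewrite edgesE => uv.
wlog {uv} uv : u v / bpar u v.
  move=> W C; case/orP: uv => uv; first exact: (W u v).
  by apply: (W v u) => //; rewrite setUC erel_csym.
(* Once the edge from [u] to its parent [v] is removed, everything reachable from [u] is a ball
   inside [u]. *)
move=> C; suff vu : val v \subset val u.
  by have := proper_sub_trans (bpar_proper uv) vu; rewrite properxx.
apply: (connect_inv (P := fun x : bvert => val x \subset val u)) C _ => // a b.
case/andP=> _; rewrite inE in_set1 edgesE => /andP[Ne /orP[ab|ba]] au; last first.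
  exact: subset_trans (proper_sub (bpar_proper ba)) au.
have [E|aNu] := eqVneq a u.
  by rewrite E (bpar_uniq ab (_ : bpar a v)) ?E ?eqxx // in Ne.
apply: bpar_min ab _; rewrite properEneq au andbT.
by apply: contra_neq aNu; apply: val_inj.
Qed.

Lemma bmark_ex i : exists v, [forall x : bvert, (i \in val x) == (val v \subset val x)].
Proof.
have Pt : i \in val btop by rewrite inE.
case: (@arg_minnP _ btop (fun v : bvert => i \in val v) (fun v => #|val v|) Pt).
move=> v iv minv; exists v; apply/forallP => x; apply/eqP; apply/idP/idP => [ix|].
  case/orP: (ball_laminar (valP v) (valP x) iv ix) => // xv.
  by have /eqP -> : val x == val v by rewrite eqEcard xv minv.
by move/subsetP; apply.
Qed.

Definition bmark (o : option I) : bvert :=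
  if o is Some i then xchoose (bmark_ex i) else btop.

Lemma bmarkE i x : (i \in val x) = (val (bmark (Some i)) \subset val x).
Proof. exact/eqP/(forallP (xchooseP (bmark_ex i))). Qed.

Definition blen := spread (fun v : bvert => depth (val v)).

Lemma blen_gt0 e : e \in edges btree -> 0 < blen e.
Proof.
case/edgesP=> u [v [uv ->]]; rewrite spread2 ?(gadj_neq uv) //.
rewrite normr_gt0 subr_eq0.
case/orP: uv => /bpar_proper/(depth_proper (valP _) (valP _)) H.
  by rewrite gt_eqF.
by rewrite lt_eqF.
Qed.

(** The two labels realizing the depth of [v] lie in different branches, because a child ball is
    strictly deeper. The third direction is the parent or, at the top, end 1. *)
Lemma bvalence v :
  (3 <= #|[set w | btree v w]| + #|[set o | bmark o == v]|)%N.
Proof.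
pose S : {set bvert + option I} :=
  [set x | match x with inl w => btree v w | inr o => bmark o == v end].
have <- : #|S| = (#|[set w | btree v w]| + #|[set o | bmark o == v]|)%N.
  rewrite -(card_imset _ (@inl_inj bvert (option I))).
  rewrite -(card_imset [set o | _] (@inr_inj bvert (option I))) -cardsUI.
  rewrite [X in (_ + #|pred_of_set X|)%N](_ : _ = set0); last first.
    apply/setP => x; rewrite !inE; apply/negP => /andP[/imsetP[y _ ->]].
    by case/imsetP.
  rewrite cards0 addn0; apply: eq_card => -[w|o]; rewrite !inE.
    rewrite mem_imset ?inE; last exact: inl_inj.
    by rewrite orbC; case: imsetP => // -[].
  by rewrite (mem_imset _ _ (@inr_inj _ _)) inE; case: imsetP => // -[].
have [i [j [ij iv jv dv _]]] := is_ballP (valP v).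
have br k : k \in val v -> exists x : bvert + option I, x \in S /\
    (x = inr (Some k) \/ exists2 w, x = inl w & bpar w v /\ k \in val w).
  move=> kv; have [mv|mNv] := eqVneq (bmark (Some k)) v.
    by exists (inr (Some k)); split; [rewrite inE mv|left].
  have := kv; rewrite bmarkE => mv.
  have kmk : k \in val (bmark (Some k)) by rewrite bmarkE.
  have [|w [wv kw]] := @bchild_ex v (bmark (Some k)) k _ kmk.
    by rewrite properEneq mv andbT; apply: contra_neq mNv; apply: val_inj.
  exists (inl w); rewrite inE /= /badj wv orbT; split=> //; right.
  by exists w.
have [x0 [x0S x0E]] : exists x0 : bvert + option I, x0 \in S /\
    (x0 = inr None \/ exists2 w, x0 = inl w & bpar v w).
  have [vT|/bpar_ex[w vw]] := eqVneq v btop.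
    by exists (inr None); split; [rewrite inE vT /=|left].
  by exists (inl w); split; [rewrite inE /= /badj vw|right; exists w].
have [xi [xiS xiE]] := br i iv; have [xj [xjS xjE]] := br j jv.
have ne0 k y : y = inr (Some k) \/ (exists2 w, y = inl w & bpar w v /\ k \in val w) ->
    x0 != y.
  case=> [->|[w -> [wv _]]]; case: x0E => [->|[w' -> vw']] //.
  apply/eqP => -[E]; rewrite -E in wv.
  have := proper_trans (bpar_proper wv) (bpar_proper vw').
  by rewrite properxx.
apply/card_gt2P; exists x0, xi, xj; split; split=> //; first exact: ne0 xiE.
  case: xiE => [->|[w -> [wv iw]]]; case: xjE => [->|[w' -> [w'v jw']]] //.
  apply/eqP => -[E]; rewrite -E in jw'.
  have := depth_proper (valP w) (valP v) (bpar_proper wv).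
  by rewrite dv ltNge depth_le // valP.
by rewrite eq_sym; apply: ne0 xjE.
Qed.

Definition bcurve : curve R I := Curve btreeP blen_gt0 bvalence.

Local Notation banc := (anc btree btop).
Local Notation bchild := (child btree btop).

Lemma bchild_par v w : bchild v w -> bpar w v.
Proof.
move: w v; apply: (tree_ind_up (root := btop) btreeP) => [v|a w aw IH v vw].
  by rewrite (negPf (child_root _ btreeP _)).
have <- := parent_uniq btreeP aw vw.
case/orP: (child_adj btreeP aw) => // pa.
have [aT|/(parent_ex btreeP)[b ba]] := eqVneq a btop.
  by have := bpar_proper pa; rewrite aT properE subsetT andbF.
have E := bpar_uniq pa (IH b ba); rewrite -E in ba.
by have := child_Nanc btreeP ba; rewrite (child_anc aw).
Qed.

Lemma bancE v w : banc v w = (val w \subset val v).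
Proof.
move: w v; apply: (tree_ind_up (root := btop) btreeP) => [v|a w aw IH v].
  apply/idP/idP => [vT|]; last first.
    rewrite subTset => /eqP E; suff -> : v = btop by apply: anc_refl.
    exact: val_inj.
  by rewrite (anc_anti btreeP vT (anc_root _ btreeP _)).
have [->|vNw] := eqVneq v w; first by rewrite anc_refl subxx.
apply/idP/idP => [vw|wv].
  case/orP: (anc_total vw (child_anc aw)) => [va|av].
    rewrite IH in va; apply: subset_trans va.
    exact/proper_sub/bpar_proper/bchild_par.
  have [<-|aNv] := eqVneq a v; first exact/proper_sub/bpar_proper/bchild_par.
  by rewrite (child_between btreeP aw av vw aNv).
apply: anc_trans (child_anc aw); rewrite IH.
apply: bpar_min (bchild_par aw) _; rewrite properEneq wv andbT.
by apply: contra_neq vNw => E; apply: val_inj.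
Qed.

Lemma bradius (v : vert bcurve) : radius v = depth (val v).
Proof.
rewrite /radius (spread_height (root := btop) btreeP) //.
  by rewrite (proj2 is_ballT).
by move=> u w /bchild_par/bpar_proper/(depth_proper (valP _) (valP _))/ltW.
Qed.

(** The meet is a ball containing [i] and [j], so its depth is at most their product; the ball
    around [i] of that radius contains both, so it is an ancestor of the meet. *)
Lemma bcurve_delta i j : i != j -> delta bcurve i j = d i j.
Proof.
move=> ij; rewrite /delta bradius; set m := cmeet _ _ _.
have ancE' (v : bvert) k : anc (tree bcurve) (vroot bcurve) v (mk bcurve k) = (k \in val v).
  by rewrite bmarkE -bancE.
have : anc (tree bcurve) (vroot bcurve) m m by apply: anc_refl.
rewrite {2}/m anc_cmeet !ancE' => /andP[im jm].
apply: le_anti; rewrite depth_le ?valP //=.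
pose b : bvert := exist _ (ball i (d i j)) (is_ball_ball ij).
have -> : d i j = depth (val b) by rewrite depthE.
apply: depth_anti; rewrite ?valP // -[_ \subset _]/(val (m : bvert) \subset val b).
rewrite -bancE; have := anc_cmeet (C := bcurve) b i j; rewrite !ancE' => ->.
by rewrite !inE eqxx lexx orbT.
Qed.

End CurveOfUltrametric.

Lemma curve_of_ultrametric (R : realType) (I : finType) (d : I -> I -> R) :
  (forall i j, d i j = d j i) ->
  (forall r i j k, i != k -> r <= d i j -> r <= d j k -> i != j -> j != k -> r <= d i k) ->
  (forall i j, 0 <= d i j) ->
  (exists i j, i != j /\ d i j = 0) ->
  exists C : curve R I, forall i j, i != j -> delta C i j = d i j.
Proof.
by move=> dC du d0 dz; exists (bcurve dC du d0 dz) => i j; apply: bcurve_delta.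
Qed.

(** * The map Psi in coordinates *)

Section LinearFunctionals.
Variables (R : realType) (V W : vectType R).

Lemma linear_lfun (f : V -> W) : linear f -> exists g : 'Hom(V, W), forall x, g x = f x.
Proof.
move=> lf; pose F : {linear V -> W} := HB.pack f (GRing.isLinear.Build R V W _ f lf).
by exists (linfun F) => x; rewrite lfunE.
Qed.

End LinearFunctionals.

(** * Coordinates on the quotient by [L] *)

Section Quotient.
Variables (R : realType) (I : finType).
Implicit Type G : sgraph I.

Lemma toREL_is_linear G : linear (@toREL R I G).
Proof. by move=> a x y; rewrite /toREL !linearP. Qed.

HB.instance Definition _ G :=
  GRing.isLinear.Build R (RE R G) (REL R G) _ (@toREL R I G) (@toREL_is_linear G).

Lemma toREL_split G (x : RE R G) :
  exists c, forall e, x e = (vsval (toREL x) : RE R G) e + c.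
Proof.
have cap0 : (((Lline R G)^C) :&: Lline R G = 0)%VS by rewrite capvC capv_compl.
have xin : x \in (((Lline R G)^C) + Lline R G)%VS by rewrite addvC addv_complf memvf.
have := daddv_pi_add cap0 xin; rewrite /toREL vsprojK ?memv_pi //.
have /vlineP[c ->] : daddv_pi (Lline R G) (Lline R G)^C x \in Lline R G by apply: memv_pi.
by move=> E; exists c => e; rewrite -{1}E !ffunE /= /GRing.scale /= mulr1.
Qed.

Lemma toREL_cst G (c : R) : toREL ([ffun=> c] : RE R G) = 0.
Proof.
have cap0 : (((Lline R G)^C) :&: Lline R G = 0)%VS by rewrite capvC capv_compl.
have cL : ([ffun=> c] : RE R G) \in Lline R G.
  apply/vlineP; exists c; apply/ffunP => e.
  by rewrite !ffunE /GRing.scale /= mulr1.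
have capC : (Lline R G :&: ((Lline R G)^C) = 0)%VS by rewrite capv_compl.
have xin : ([ffun=> c] : RE R G) \in (((Lline R G)^C) + Lline R G)%VS.
  by rewrite addvC addv_complf memvf.
have := daddv_pi_add cap0 xin; rewrite (daddv_pi_id capC cL).
by move/(canRL (addrK _)); rewrite subrr /toREL => ->; rewrite linear0.
Qed.

Lemma toREL_eqP G (x y : RE R G) :
  toREL x = toREL y <-> exists c, forall e, x e = y e + c.
Proof.
split=> [E|[c xy]].
  have [a ax] := toREL_split x; have [b yb] := toREL_split y.
  by exists (a - b) => e; rewrite ax yb E -addrA [b + _]addrC addrNK.
have -> : x = y + [ffun=> c] by apply/ffunP => e; rewrite xy !ffunE.
by rewrite linearD /= toREL_cst addr0.
Qed.

(** Single coordinates do not descend modulo [L], but their differences do; these are the only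
    functionals needed on cones. *)
Lemma toREL_functional G (e f : edge_of G) :
  exists g : 'Hom(REL R G, R^o), forall x : RE R G, g (toREL x) = x e - x f.
Proof.
have [|g gE] := @linear_lfun R (REL R G) R^o
  (fun y => (vsval y : RE R G) e - (vsval y : RE R G) f).
  move=> a x y /=; rewrite !ffunE /= /GRing.scale /=; ring.
exists g => x; rewrite gE; have [c xc] := toREL_split x.
by rewrite !xc opprD addrACA subrr addr0.
Qed.

Lemma piG_toREL G (x : RE R (Kgraph I)) :
  piG G (toREL x) = toREL [ffun e => x (edge_toK e)].
Proof.
apply/toREL_eqP; have [c xc] := toREL_split x; exists (- c) => e.
by rewrite !ffunE xc addrK.
Qed.

Definition indic G (F : {set {set I}}) : RE R G := [ffun e => (val e \in F)%:R].

Lemma rhoE G F : rho R G F = toREL (- indic G F).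
Proof.
rewrite /rho linearN /=; congr (- _); rewrite -linear_sum /=; congr toREL.
apply/ffunP => e; rewrite sum_ffunE ffunE; have [eF|eF] := boolP (val e \in F).
  rewrite (bigD1 e) //= ffunE eqxx big1 ?addr0 // => f /andP[_ fe].
  by rewrite ffunE eq_sym (negPf fe).
rewrite big1 // => f fF; rewrite ffunE; case: eqP => // ef.
by rewrite ef fF in eF.
Qed.

(* On an edge [set u; v] the double sum counts [d u v] twice. *)
Definition edge_val (d : I -> I -> R) (e : {set I}) : R :=
  (\sum_(u in e) \sum_(v in e | v != u) d u v) / 2.

Lemma edge_val2 d u v : (forall i j, d i j = d j i) -> u != v ->
  edge_val d [set u; v] = d u v.
Proof.
move=> dC uv; rewrite /edge_val !(big_setU1, big_set1) ?inE //=.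
rewrite 2!big_mkcondr /= !(big_setU1, big_set1) ?inE //= !eqxx.
by rewrite uv eq_sym uv (dC v u) /=; lra.
Qed.

Definition edge_vec G (d : I -> I -> R) : RE R G := [ffun e => edge_val d (val e)].

Lemma edge_ind G (P : edge_of G -> Prop) :
  (forall u v (uv : [set u; v] \in edges G), G u v -> P (exist _ [set u; v] uv)) ->
  forall e, P e.
Proof.
move=> H [e eG]; have /edgesP[u [v [uv E]]] := eG; subst e.
exact: H.
Qed.

End Quotient.

(** * The coordinates of [Psi] as negated Gromov products *)

Section PsiFormula.
Variables (R : realType) (I : finType).
Implicit Types (C : curve R I) (G : sgraph I).

Lemma mem_cut_flat C r u v : u != v ->
  ([set u; v] \in cut_flat C r) = (r <= delta C u v).
Proof.
move=> uv; rewrite inE edgesE [Kgraph _ _ _]uv /=; apply/existsP/le_delta.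
  case=> x /andP[rx]; rewrite subUset !sub1set !beyondE => /andP[ux vx].
  by exists x.
case=> x [rx ux vx]; exists x.
by rewrite rx subUset !sub1set !beyondE ux vx.
Qed.

(** The factor keeps the steps up to [x], and they telescope because [x] is itself one of the
    values. *)
Lemma sum_steps (s : seq R) x : sorted <=%R s -> x \in s ->
  \sum_(t < (size s).-1) (s`_t.+1 - s`_t) * (s`_t.+1 <= x)%R%:R = x - s`_0.
Proof.
case: s => // a s; elim: s a => [|b s IHs] a.
  by rewrite inE => _ /eqP ->; rewrite big_ord0 subrr.
move=> abs xabs; rewrite big_ord_recl /=.
have [xbs|xNbs] := boolP (x \in b :: s).
  have /= -> := IHs b (path_sorted abs) xbs.
  have -> : b <= x.
    have := order_path_min le_trans (path_sorted abs).
    by move: xbs; rewrite inE => /orP[/eqP ->//|xs] /allP; apply.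
  by rewrite mulr1; ring.
have {xabs}xa : x = a by move: xabs; rewrite inE (negPf xNbs) orbF => /eqP.
have lt_a y : y \in b :: s -> (y <= x) = false.
  move=> ybs; have := order_path_min le_trans abs => /allP/(_ y ybs) ay.
  by apply/negP => yx; move: xNbs; rewrite (@le_anti _ _ x y) ?ybs // yx xa ay.
rewrite lt_a ?mem_head // mulr0 add0r big1 ?xa ?subrr // => t _.
by rewrite -[_`_ _]/((b :: s)`_t.+1) -?xa lt_a ?mulr0 // mem_nth //= ltnS.
Qed.

Lemma mem_radii C (v : vert C) : radius v \in radii C.
Proof. by rewrite mem_sort mem_undup map_f ?mem_enum. Qed.

Lemma radii0 C : (radii C)`_0 = 0.
Proof.
have s0 : 0 \in radii C by rewrite -(radius_root C) mem_radii.
have : sorted <=%R (radii C) by apply: sort_sorted; apply: le_total.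
have : all (>= 0) (radii C).
  apply/allP => x; rewrite mem_sort mem_undup => /mapP[v _ ->].
  exact: radius_ge0.
case: (radii C) s0 => //= a s; rewrite inE => /orP[/eqP <-//|s0] /andP[a0 _].
move=> /(order_path_min le_trans)/allP/(_ 0 s0) a0'.
by apply: le_anti; rewrite a0 a0'.
Qed.

(** The flat cut at radius [r] contributes its step to the pairs with product at least [r], so the
    steps up to [delta C u v] add up to it. *)
Lemma PsiE C : Psi C = toREL (- edge_vec (Kgraph I) (delta C)).
Proof.
rewrite /Psi; under eq_bigr do rewrite rhoE -linearZ /=.
rewrite -linear_sum /=; congr toREL; apply/ffunP.
apply: edge_ind => u v uvG uv; rewrite sum_ffunE !ffunE /= edge_val2 //; last exact: deltaC.
under eq_bigr do rewrite !ffunE /= mem_cut_flat // /GRing.scale /= mulrN.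
rewrite sumrN; congr (- _); rewrite sum_steps ?radii0 ?subr0 //.
  by apply: sort_sorted; apply: le_total.
exact: mem_radii.
Qed.

Lemma PsiGE G C : PsiG G C = toREL (- edge_vec G (delta C)).
Proof.
rewrite /PsiG PsiE piG_toREL; congr toREL.
by apply/ffunP => e; rewrite !ffunE.
Qed.

End PsiFormula.

(** * Chains of flats and cones of curves *)

Section Chains.
Variables (R : realType) (I : finType) (G : sgraph I).
Implicit Types (c : seq {set {set I}}) (F : {set {set I}}).

(** Appending [edges G] puts the properness of the last flat into the path, so that both ends of the
    chain are steps like the others. *)
Definition strict_chain c : Prop :=
  path (fun A B : {set {set I}} => A \proper B) set0 (rcons c (edges G)).

Lemma chain_last_sub (A F : {set {set I}}) c :
  path (fun A B : {set {set I}} => A \proper B) A c -> F \in A :: c ->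
  F \subset last A c.
Proof.
elim: c A F => [|B c IH] A F /=; first by rewrite inE => _ /eqP ->.
move=> /andP[/proper_sub AB Bc]; rewrite inE => /orP[/eqP ->|]; last exact: IH.
exact: subset_trans AB (IH _ _ Bc (mem_head _ _)).
Qed.

Lemma flat_chainP c : edges G != set0 -> flat_chain G c <->
  strict_chain c /\ forall F, F \in c -> flat G F.
Proof.
move=> G0; rewrite /flat_chain /strict_chain rcons_path.
split=> [/andP[pc /allP allc]|[/andP[pc pl] fl]].
  split=> [|F /allc/andP[]//]; rewrite pc /=.
  have := mem_last set0 c; rewrite inE => /orP[/eqP ->|/allc/andP[]//].
  by rewrite proper0.
rewrite pc; apply/allP => F Fc; rewrite fl //=; apply: sub_proper_trans pl.
by apply: chain_last_sub pc _; rewrite inE Fc orbT.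
Qed.

Section OneChain.
Variable c : seq {set {set I}}.
Hypothesis chain_c : strict_chain c.

Local Notation L := (set0 :: rcons c (edges G)).

Lemma chain_nth i j : (i <= j)%N -> (j < size c)%N -> nth set0 c i \subset nth set0 c j.
Proof.
move=> ij jc; have pt : transitive (fun A B : {set {set I}} => A \subset B).
  by move=> ? ? ?; apply: subset_trans.
have : sorted (fun A B : {set {set I}} => A \subset B) c.
  move: chain_c; rewrite /strict_chain rcons_path => /andP[/path_sorted + _].
  by apply: sub_sorted => A B; apply: proper_sub.
move=> /(sorted_leq_nth pt (fun A => subxx A) set0).
by apply=> //; rewrite inE //; apply: leq_ltn_trans jc.
Qed.

Lemma chain_total A B : A \in c -> B \in c -> (A \subset B) || (B \subset A).
Proof.
move=> Ac Bc; rewrite -(nth_index set0 Ac) -(nth_index set0 Bc).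
case/orP: (leq_total (index A c) (index B c)) => le_AB.
  by rewrite chain_nth ?index_mem.
by rewrite (chain_nth le_AB) ?index_mem ?orbT.
Qed.

(** [e t] is an edge entering at step [t]: in the flat of index [t] but not in the one before. The
    last, [e (size c)], lies outside every flat of the chain. *)
Lemma chain_reps : exists e : nat -> edge_of G, forall t j,
  (t <= size c)%N -> (j < size c)%N -> (val (e t) \in nth set0 c j) = (t <= j)%N.
Proof.
have step t : (t <= size c)%N -> nth set0 L t \proper nth set0 L t.+1.
  move=> tc; have /(pathP set0) := chain_c.
  by move=> /(_ t); rewrite size_rcons ltnS; apply.
have Lc j : (j < size c)%N -> nth set0 L j.+1 = nth set0 c j.
  by move=> jc; rewrite /= nth_rcons jc.
have LG t : (t <= size c)%N -> nth set0 L t.+1 \subset edges G.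
  move=> tc; have [k E] : exists k, (size c - t)%N = k by exists (size c - t)%N.
  elim: k t tc E => [|k IH] t tc E.
    have -> : t = size c by apply/eqP; rewrite eqn_leq tc -subn_eq0 E.
    by rewrite /= nth_rcons ltnn eqxx.
  have tc' : (t < size c)%N by rewrite -subn_gt0 E.
  apply: subset_trans (proper_sub (step t.+1 tc')) (IH _ tc' _).
  by rewrite subnS E.
have ex t : exists e : edge_of G, (t <= size c)%N ->
    val e \in nth set0 L t.+1 /\ val e \notin nth set0 L t.
  have [tc|tc] := leqP t (size c).
    have /properP[_ [e eL eNL]] := step t tc.
    by exists (exist _ e (subsetP (LG t tc) _ eL)).
  have /properP[_ [e eL _]] := step 0%N isT.
  by exists (exist _ e (subsetP (LG 0%N isT) _ eL)).
have [e eP] := boolp.choice ex; exists e => t j tc jc.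
have [et eNt] := eP t tc; apply/idP/idP => [ej|tj].
  rewrite leqNgt; apply: contraNN eNt => jt.
  case: t tc jt {et} => // t tc jt in ej *; rewrite Lc //.
  by apply: (subsetP (chain_nth _ _)) ej.
rewrite Lc ?(leq_ltn_trans tj) // in et.
exact: (subsetP (chain_nth tj jc)) et.
Qed.

(** The level of an edge is the index of the first flat containing it, and [size c] if there is
    none. *)
Lemma chain_levelE (e : {set I}) j : (j < size c)%N ->
  (e \in nth set0 c j) = (find (fun F => e \in F) c <= j)%N.
Proof.
move=> jc; apply/idP/idP => [ej|sj].
  by rewrite leqNgt; apply/negP => /(before_find set0); rewrite ej.
apply: (subsetP (chain_nth sj jc)); apply: (@nth_find _ set0 (fun F => e \in F)).
by rewrite has_find (leq_ltn_trans sj).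
Qed.

(** The difference of the coordinates at [e t.+1] and [e t]: only the flat of index [t] contains
    exactly one of these two edges. *)
Lemma chain_dual t : (t < size c)%N -> exists f : 'Hom(REL R G, R^o),
  (forall j, (j < size c)%N -> f (rho R G (nth set0 c j)) = (j == t)%:R) /\
  (forall x, latticeREL R G x -> f x \is a Num.int).
Proof.
move=> tc; have [e eE] := chain_reps.
have [f fE] := toREL_functional R (e t.+1) (e t); exists f; split=> [j jc|_ [x xint <-]].
  rewrite rhoE fE !ffunE !eE // ?(ltnW tc) // eq_sym.
  by case: ltngtP => _; rewrite /= ?subrr ?opprK ?oppr0 ?add0r ?addr0 ?addNr.
by rewrite fE rpredB //; apply: xint.
Qed.

Definition chain_gens : seq (REL R G) := [seq rho R G F | F <- c].

Lemma chain_sumE (a : nat -> R) : \sum_(i < size chain_gens) a i *: chain_gens`_i =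
  toREL (- \sum_(i < size c) a i *: indic R G (nth set0 c i)).
Proof.
rewrite size_map -sumrN linear_sum; apply: eq_bigr => i _.
by rewrite (nth_map set0) // rhoE -scalerN linearZ.
Qed.

Lemma sum_levels (u : nat -> R) k s : (s <= k)%N ->
  \sum_(t < k) (u t - u t.+1) * (s <= t)%N%:R = u s - u k.
Proof.
elim: k => [|k IH]; first by rewrite leqn0 => /eqP ->; rewrite big_ord0 subrr.
rewrite leq_eqVlt big_ord_recr /= => /orP[/eqP ->|].
  rewrite ltnn mulr0 addr0 subrr big1 // => t _.
  by rewrite leqNgt ltnS ltnW ?mulr0 // ltnS ltnW.
by rewrite ltnS => sk; rewrite IH // sk mulr1; ring.
Qed.

(** The preorder of the edges by [d] is the one given by the chain, so the flats of the chain are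
    superlevel sets of [d] and the edges outside all of them have the least value. *)
Definition same_order (d : I -> I -> R) := forall e f : edge_of G,
  (edge_val d (val e) <= edge_val d (val f)) <->
  (forall F, F \in c -> val e \in F -> val f \in F).

Lemma edge_val_delta_ge0 (C : curve R I) (e : edge_of G) :
  0 <= edge_val (delta C) (val e).
Proof.
move: e; apply: edge_ind => u v uvG uv /=.
by rewrite edge_val2 ?(gadj_neq uv) ?delta_ge0 //; apply: deltaC.
Qed.

Lemma compat_edge (C D : curve R I) (e f : edge_of G) : compat C D ->
  edge_val (delta C) (val e) <= edge_val (delta C) (val f) ->
  edge_val (delta D) (val e) <= edge_val (delta D) (val f).
Proof.
move=> cmp; move: e f; apply: edge_ind => u v uvG uv.
apply: edge_ind => x y xyG xy /=.
rewrite !edge_val2 ?(gadj_neq uv) ?(gadj_neq xy) //; try exact: deltaC.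
exact: cmp.
Qed.

(** Weakly increasing functions of [delta C] are, up to a constant, nonnegative combinations of the
    indicators of its superlevel sets, which on edges are the flats of [c]. *)
Lemma image_coneE (C : curve R I) : same_order (delta C) ->
  [set x | exists2 D, rad_cone C D & PsiG G D = x]%classic = conic chain_gens.
Proof.
move=> ord; have [e eE] := chain_reps.
have eF t (f : edge_of G) : (t < size c)%N ->
    edge_val (delta C) (val (e t)) <= edge_val (delta C) (val f) <->
    val f \in nth set0 c t.
  move=> tc; apply: (iff_trans (ord _ _)); split=> [H|ft F Fc].
    by apply: H; rewrite ?mem_nth // eE // ltnW.
  rewrite -(nth_index set0 Fc) eE ?index_mem ?(ltnW tc) // => tF.
  by apply: (subsetP (chain_nth tF _)) ft; rewrite index_mem.
apply/seteqP; split=> x /=.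
  case=> D /rad_coneP cmp <-; pose g t := edge_val (delta D) (val (e t)).
  have g_dec t : (t < size c)%N -> g t.+1 <= g t.
    move=> tc; apply: (compat_edge cmp); apply/ord => F Fc.
    rewrite -(nth_index set0 Fc) !eE ?index_mem ?(ltnW tc) //.
    exact: ltnW.
  (* The coefficients are the drops of [delta D] between consecutive steps; indices beyond the chain
     get 0 to keep all of them nonnegative. *)
  pose a t := if (t < size c)%N then g t - g t.+1 else 0.
  exists a; rewrite /a.
    by move=> t; case: ifP => // tc; rewrite subr_ge0 g_dec.
  (* The remaining constant is the value of [delta D] on the edges outside all flats. *)
  rewrite (chain_sumE a) PsiGE; apply/toREL_eqP; exists (- g (size c)) => f.
  rewrite !ffunE sum_ffunE /=; pose s := find (fun F => val f \in F) c.
  have sc : (s <= size c)%N by apply: find_size.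
  have sE j : (j < size c)%N -> (val f \in nth set0 c j) = (s <= j)%N by apply: chain_levelE.
  have -> : edge_val (delta D) (val f) = g s.
    apply: le_anti; rewrite !(compat_edge cmp) //=; apply/ord => F Fc;
      rewrite -(nth_index set0 Fc) sE ?index_mem // eE ?index_mem //.
  rewrite (eq_bigr (fun t : 'I_(size c) => (g t - g t.+1) * (s <= t)%N%:R)).
    by rewrite sum_levels //; ring.
  by move=> t _; rewrite !ffunE /a ltn_ord sE.
case=> a a0 ->.
(* Composing all products of [C] with this increasing step function, not only those of edges,
   preserves the ultrametric inequality. *)
pose phi x := \sum_(t < size c) a t * (edge_val (delta C) (val (e t)) <= x)%R%:R.
have phi_mono y z : y <= z -> phi y <= phi z.
  move=> yz; apply: ler_sum => t _; rewrite ler_wpM2l // ler_nat.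
  case: (leP _ y) => // ty; by rewrite (le_trans ty yz).
have phi_ge0 y : 0 <= phi y by apply: sumr_ge0 => t _; rewrite mulr_ge0 // ler0n.
have [|r i j k _ rij rjk _ _||//|D dD] :=
  @curve_of_ultrametric R I (fun i j => phi (delta C i j)).
- by move=> i j; rewrite deltaC.
- case: (leP (delta C i j) (delta C j k)) => [le_d|/ltW le_d].
    by apply: le_trans rij (phi_mono _ _ _); apply: delta_ultra le_d.
  by apply: le_trans rjk (phi_mono _ _ _); apply: delta_ultra le_d _.
- by move=> i j; apply: phi_ge0.
- have [i [j [ij d0]]] := delta0_ex C; exists i, j; split=> //.
  (* Each [e t] in the sum lies in a flat that misses [e (size c)], so its value is positive and
     [phi] vanishes at 0. *)
  rewrite d0 /phi big1 // => t _; rewrite leNgt.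
  have -> : 0 < edge_val (delta C) (val (e t)); last by rewrite mulr0.
  apply: le_lt_trans (edge_val_delta_ge0 C (e (size c))) _.
  rewrite ltNge; apply/negP => /(eF t _ (ltn_ord t)).
  by rewrite eE // leqNgt ltn_ord.
exists D; first by apply/rad_coneP/compat_offdiag => i j k h ij kh /phi_mono; rewrite !dD.
rewrite chain_sumE PsiGE; congr toREL; congr (- _); apply/ffunP.
apply: edge_ind => u v uvG uv; rewrite ffunE sum_ffunE /=.
have uNv := gadj_neq uv.
rewrite edge_val2 //; last exact: deltaC.
rewrite dD // /phi; apply: eq_bigr => t _; rewrite !ffunE /=.
have := eF t (exist _ [set u; v] uvG) (ltn_ord t).
rewrite /= edge_val2 //; last exact: deltaC.
by case=> H1 H2; congr (_ * _%:R); congr nat_of_bool; apply/idP/idP.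
Qed.

End OneChain.
End Chains.

(** * Chains from level sets, and curves from chains *)

Section LevelSets.
Variables (R : realType) (I : finType) (G : sgraph I).
Hypothesis G_conn : gconnected G.
Implicit Types (C D : curve R I) (F : {set {set I}}) (c : seq {set {set I}}).

Lemma delta_connect C (e : rel I) r u v :
  (forall a b, e a b -> r <= delta C a b) -> connect e u v -> u = v \/ r <= delta C u v.
Proof.
move=> er uv; apply: (connect_inv (P := fun x => u = x \/ r <= delta C u x) _ uv).
  move=> a b /er ab [->|ua]; right => //.
  exact: delta_ultra ua ab.
by left.
Qed.

(** If [delta C] were positive on all edges, its minimum there would bound it from below along every
    path of the connected graph, hence on the pair of product 0. This fixes the additive constant
    modulo [L]. *)
Lemma delta_edge0 C : exists u v, G u v /\ delta C u v = 0.
Proof.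
have [i [j [ij d0]]] := delta0_ex C.
apply: contrapT => nex; have gt0 u v : G u v -> 0 < delta C u v.
  move=> uv; rewrite lt_neqAle delta_ge0 andbT eq_sym.
  by apply: contra_notN nex => /eqP E; exists u, v.
pose P (p : I * I) := G p.1 p.2.
have [x ix] : exists x, G i x.
  have /connectP[[|x p] /=] := G_conn i j; first by move=> _ E; rewrite E eqxx in ij.
  by case/andP=> ix _ _; exists x.
pose p0 := [arg min_(p < ((i, x) : I * I) | P p) delta C p.1 p.2]%O.
have [Pp0 minp] : P p0 /\ forall p, P p -> delta C p0.1 p0.2 <= delta C p.1 p.2.
  by rewrite /p0; case: arg_minP.
have [E|] := @delta_connect C G (delta C p0.1 p0.2) i j
  (fun a b ab => minp (a, b) ab) (G_conn i j).
  by rewrite E eqxx in ij.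
by rewrite d0 leNgt gt0.
Qed.

Definition level_set C (r : R) : {set {set I}} :=
  [set e in edges G | r <= edge_val (delta C) e].

Lemma mem_level_set C r u v : G u v ->
  ([set u; v] \in level_set C r) = (r <= delta C u v).
Proof.
move=> uv; rewrite inE edgesE uv edge_val2 ?(gadj_neq uv) //.
exact: deltaC.
Qed.

Lemma val_level_set C r (e : edge_of G) :
  (val e \in level_set C r) = (r <= edge_val (delta C) (val e)).
Proof. by rewrite /level_set in_set (valP e). Qed.

Lemma flat_level_set C r : flat G (level_set C r).
Proof.
apply/flatP; split; first by apply/subsetP => e; rewrite inE => /andP[].
move=> u v uv /(@delta_connect C _ r)[a b /andP[_]|E|].
- move=> ab; rewrite -mem_level_set //.
  by move: ab; rewrite inE => /andP[]; rewrite edgesE.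
- by rewrite E gadj_irr in uv.
- by rewrite mem_level_set.
Qed.

Lemma flat_chain_ex C : exists2 c, flat_chain G c & same_order G c (delta C).
Proof.
pose val_ (e : edge_of G) := edge_val (delta C) (val e).
(* The levels decrease because superlevel sets grow as the level drops. The value 0 is left out,
   since its level set is all of [edges G]. *)
pose vals := rev (sort <=%R (undup [seq val_ e | e <- enum {: edge_of G} & 0 < val_ e])).
have memv r : r \in vals <-> exists2 e, 0 < val_ e & r = val_ e.
  rewrite mem_rev mem_sort mem_undup; split=> [/mapP[e]|[e e0 ->]].
    by rewrite mem_filter => /andP[e0 _] ->; exists e.
  by apply: map_f; rewrite mem_filter e0 mem_enum.
exists [seq level_set C r | r <- vals]; last first.
  move=> e f; split=> [ef F /mapP[r _ ->]|H].
    by rewrite !val_level_set => re; apply: le_trans ef.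
  have [e0|] := leP (edge_val (delta C) (val e)) 0.
    exact: le_trans (edge_val_delta_ge0 _ _).
  move=> e0; have ev : val_ e \in vals by apply/memv; exists e.
  have := H _ (map_f (level_set C) ev).
  by rewrite !val_level_set lexx; apply.
apply/andP; split; last first.
  apply/allP => F /mapP[r /memv[e e0 ->] ->]; rewrite flat_level_set /=.
  rewrite properEneq (flat_sub (flat_level_set _ _)) andbT.
  have [u [v [uv d0]]] := delta_edge0 C; apply: contraTneq uv => E.
  apply/negP => uv; have : [set u; v] \in edges G by rewrite edgesE.
  by rewrite -E mem_level_set // d0 leNgt e0.
have : sorted (fun x y => y < x) vals.
  by rewrite rev_sorted sort_lt_sorted undup_uniq.
have lvlP r : r \in vals -> forall A : {set {set I}}, (forall e, e \in A -> r < edge_val (delta C) e) ->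
    A \subset edges G -> A \proper level_set C r.
  move=> /memv[e _ re] A Ar AG; apply/properP; split.
    apply/subsetP => f fA; rewrite /level_set in_set (subsetP AG) //=.
    exact/ltW/Ar.
  exists (val e); first by rewrite val_level_set re.
  by apply/negP => /Ar; rewrite re ltxx.
case: vals lvlP {memv} => //= r s lvlP rs; rewrite lvlP ?mem_head ?sub0set //=; last first.
  by move=> e; rewrite inE.
elim: s r rs lvlP => //= r' s IH r /andP[r'r rs] lvlP.
rewrite IH // ?andbT; last by move=> x xs; apply: lvlP; rewrite inE xs orbT.
apply: lvlP; first by rewrite !inE eqxx orbT.
  by move=> e; rewrite /level_set in_set => /andP[_]; apply: lt_le_trans.
exact/flat_sub/flat_level_set.
Qed.

Lemma edge_ex : (1 < #|I|)%N -> exists u v, G u v.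
Proof.
move=> /card_gt1P[u [v [_ _ uv]]]; have /connectP[[|x p] /=] := G_conn u v.
  by move=> _ E; rewrite E eqxx in uv.
by case/andP=> ux _ _; exists u, x.
Qed.

Lemma edges_neq0 : (1 < #|I|)%N -> edges G != set0.
Proof.
by move=> /edge_ex[u [v uv]]; apply/set0Pn; exists [set u; v]; rewrite edgesE.
Qed.

Lemma curve_ext C D : (forall i j, i != j -> delta C i j = delta D i j) ->
  forall i j, delta C i j = delta D i j.
Proof.
move=> E i j; have [<-|ij] := eqVneq i j; last exact: E.
have [k ik Ck] := delta_diag_ex C i; have [h ih Dh] := delta_diag_ex D i.
apply: le_anti; rewrite -{1}Ck E // delta_le_diag /=.
by rewrite -Dh -E // delta_le_diag.
Qed.

(** Counting the flats that connect the pair, instead of those that contain it as an edge, also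
    gives a value to non-adjacent labels. *)
Definition chain_dist c (i j : I) : R := \sum_(F <- c) (connect (erel F) i j)%:R.

Section ChainDist.
Variable c : seq {set {set I}}.
Hypotheses (Gn0 : edges G != set0) (flc : flat_chain G c).

Let chain_c : strict_chain G c := proj1 (proj1 (flat_chainP c Gn0) flc).
Let flat_c : forall F, F \in c -> flat G F := proj2 (proj1 (flat_chainP c Gn0) flc).

Lemma mem_flat_chain F u v : F \in c -> G u v ->
  ([set u; v] \in F) = connect (erel F) u v.
Proof.
move=> /flat_c/flatP[FG flF] uv; apply/idP/idP; last exact: flF.
by move=> uvF; apply: connect1; rewrite /= (gadj_neq uv).
Qed.

Lemma chain_dist_mono i j k h :
  (forall F, F \in c -> connect (erel F) i j -> connect (erel F) k h) ->
  chain_dist c i j <= chain_dist c k h.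
Proof.
move=> H; rewrite /chain_dist big_seq [leRHS]big_seq; apply: ler_sum => F Fc.
by rewrite ler_nat; case: connect (H F Fc) => // ->.
Qed.

(** The flats connecting a given pair form a final segment of the chain, so comparing their numbers
    compares the segments. *)
Lemma chain_dist_le i j k h : chain_dist c i j <= chain_dist c k h <->
  (forall F, F \in c -> connect (erel F) i j -> connect (erel F) k h).
Proof.
split=> [le_d F0 F0c ij|]; last exact: chain_dist_mono.
apply: contraTT le_d => kh; rewrite -ltNge /chain_dist.
rewrite (big_rem _ F0c) [ltRHS](big_rem _ F0c) /= (negPf kh) ij add0r.
rewrite -[ltLHS]add0r ltr_leD // big_seq [leRHS]big_seq; apply: ler_sum => F /mem_rem Fc.
rewrite ler_nat; case khF : (connect (erel F) k h) => //.
case/orP: (chain_total chain_c F0c Fc) => [sub|sub].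
  by rewrite (connect_erel_sub sub ij).
by rewrite (connect_erel_sub sub khF) in kh.
Qed.

Lemma chain_dist_total i j k h :
  (forall F, F \in c -> connect (erel F) i j -> connect (erel F) k h) \/
  (forall F, F \in c -> connect (erel F) k h -> connect (erel F) i j).
Proof.
by case/orP: (le_total (chain_dist c i j) (chain_dist c k h)) => /chain_dist_le;
  [left|right].
Qed.

Lemma flat_chain_curve : exists C, [/\ same_order G c (delta C), gstable G C &
  forall i j, i != j -> delta C i j = chain_dist c i j].
Proof.
have dC i j : chain_dist c i j = chain_dist c j i.
  by apply: eq_bigr => F _; rewrite erel_csym.
have [|||C CE] := @curve_of_ultrametric R I (chain_dist c) dC.
- move=> r i j k _ rij rjk _ _.
  have [H|H] := chain_dist_total i j j k.
    apply: le_trans rij (chain_dist_mono _) => F Fc ij.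
    exact: connect_trans ij (H F Fc ij).
  apply: le_trans rjk (chain_dist_mono _) => F Fc jk.
  exact: connect_trans (H F Fc jk) jk.
- by move=> i j; apply: sumr_ge0 => F _; rewrite ler0n.
(* An edge outside the last flat is connected by no flat of the chain and gives the pair of product
   0. *)
- have := chain_c; rewrite /strict_chain rcons_path => /andP[pc /properP[_ [e eG eL]]].
  have /edgesP[u [v [uv ee]]] := eG; rewrite ee in eL.
  exists u, v; split; first exact: gadj_neq uv.
  rewrite /chain_dist big_seq big1 // => F Fc.
  rewrite -mem_flat_chain //; case uvF : (_ \in F) => //.
  case/negP: eL; apply: subsetP uvF; rewrite -(nth_index set0 Fc) (last_nth set0).
  have c0 : (0 < size c)%N by case: {+}c Fc.
  case E : (size c) => [|n]; first by rewrite E in c0.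
  rewrite -[nth _ (_ :: _) _]/(nth set0 c n); apply: (chain_nth chain_c).
    by rewrite -ltnS -E index_mem.
  by rewrite E.
have ordC : same_order G c (delta C).
  apply: edge_ind => u v uvG uv; apply: edge_ind => x y xyG xy /=.
  have [uNv xNy] := (gadj_neq uv, gadj_neq xy).
  rewrite !edge_val2 //; try exact: deltaC.
  rewrite !CE //; apply: (iff_trans (chain_dist_le _ _ _ _)).
  by split=> H F Fc; have := H F Fc; rewrite !mem_flat_chain.
exists C; split=> //; apply/gstableP/gst_delta => i j ij.
rewrite CE // => d0.
pose P F := connect (erel F) i j.
have hasP : has P c.
  apply: contraTT d0 => /hasPn H; rewrite -leNgt /chain_dist big_seq big1 // => F /H.
  by rewrite /P => /negPf ->.
have F0c : nth set0 c (find P c) \in c by rewrite mem_nth // -has_find.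
(* The first flat connecting [i] and [j] contains an edge from [i] to some [x], and so do all later
   ones; [i] and [x] witness stability. *)
have /connectP[[|x p] /=] := nth_find set0 hasP.
  by move=> _ E; rewrite E eqxx in ij.
case/andP=> /andP[ix ixF] _ _; exists i, x.
have Gix : G i x.
  by rewrite -edgesE (subsetP (flat_sub (flat_c F0c))).
rewrite Gix -CE // delta_le_diag [leRHS]CE // CE //; split=> //.
apply: chain_dist_mono => F Fc ijF; rewrite -mem_flat_chain //.
apply: (subsetP _ _ ixF); rewrite -(nth_index set0 Fc).
apply: (chain_nth chain_c); rewrite ?index_mem // leqNgt.
by apply/negP => /(before_find set0); rewrite nth_index // /P ijF.
Qed.

End ChainDist.

End LevelSets.

(** * The identification *)

Section Identification.
Variables (R : realType) (I : finType) (G : sgraph I).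
Hypotheses (G_conn : gconnected G) (I_gt1 : (1 < #|I|)%N).
Implicit Types (C D : curve R I).

Let Gn0 : edges G != set0 := edges_neq0 G_conn I_gt1.

(** Stated for any class containing the stable curves, since it serves both for all curves and for
    the stable ones alone. *)
Lemma image_cones_Bfan (M : curve R I -> Prop) : (forall C, gstable G C -> M C) ->
  image_cones (@PsiG R I G) M = Bfan R G.
Proof.
move=> stM; apply/seteqP; split=> s /=.
  case=> C _ ->; have [c flc ord] := flat_chain_ex G_conn C.
  have [chain_c _] := proj1 (flat_chainP c Gn0) flc.
  by rewrite (image_coneE chain_c ord); exists c.
case=> c flc <-; have [C [ord st _]] := flat_chain_curve R Gn0 flc.
have [chain_c _] := proj1 (flat_chainP c Gn0) flc.
by exists C; [exact: stM|rewrite (image_coneE chain_c ord)].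
Qed.

Lemma piG_image_cones :
  [set piG G @` s | s in image_cones (@Psi R I) (fun=> True)]%classic = Bfan R G.
Proof.
rewrite -(@image_cones_Bfan (fun=> True)) //.
have E C : (piG G @` [set x | exists2 D, rad_cone C D & Psi D = x] =
    [set x | exists2 D, rad_cone C D & PsiG G D = x])%classic.
  apply/seteqP; split=> x /=; first by case=> _ [D CD <-] <-; exists D.
  by case=> D CD <-; exists (Psi D) => //; exists D.
apply/seteqP; split=> s /=; first by case=> _ [C _ ->] <-; exists C.
by case=> C _ ->; exists [set x | exists2 D, rad_cone C D & Psi D = x]%classic => //;
  exists C.
Qed.

Lemma plen_linear (T : finType) a (l l' : {ffun {set T} -> R^o}) u p :
  plen (a *: l + l') u p = a * plen l u p + plen l' u p.
Proof.
elim: p u => [|v p IHp] u /=; first by rewrite mulr0 addr0.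
by rewrite IHp !ffunE /GRing.scale /=; ring.
Qed.

(** The geodesics in the tree of [C] do not depend on the lengths, so heights are linear in [l]. *)
Lemma PsiG_linear C : exists phi : 'Hom({ffun {set vert C} -> R^o}, REL R G),
  forall l D, cone_point (C := C) l D -> PsiG G D = phi l.
Proof.
pose d (l : {ffun {set vert C} -> R^o}) i j := gdist (tree C) l (vroot C) (cmeet C i j).
have [|phi phiE] := @linear_lfun R {ffun {set vert C} -> R^o} (REL R G)
  (fun l => toREL (- edge_vec G (d l))).
  move=> a l l' /=; rewrite -linearP /= scalerN -opprD; congr (toREL (- _)).
  apply/ffunP => e; rewrite !ffunE /edge_val /GRing.scale /= mulrA -mulrDl.
  congr (_ / 2); rewrite mulr_sumr -big_split; apply: eq_bigr => u _ /=.
  rewrite mulr_sumr -big_split; apply: eq_bigr => v _ /=.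
  exact: plen_linear.
exists phi => l D CD; rewrite phiE PsiGE; congr (toREL (- _)).
apply/ffunP => e; rewrite !ffunE; congr (_ / 2).
apply: eq_bigr => u _; apply: eq_bigr => v _.
exact: cone_point_delta CD _ _.
Qed.

Lemma PsiG_delta C D : (forall i j, delta C i j = delta D i j) -> PsiG G C = PsiG G D.
Proof.
move=> E; rewrite !PsiGE; congr (toREL (- _)).
apply/ffunP => e; rewrite !ffunE; congr (_ / 2).
by apply: eq_bigr => u _; apply: eq_bigr => v _.
Qed.

Lemma PsiG_edge C D : PsiG G C = PsiG G D ->
  forall u v, G u v -> delta C u v = delta D u v.
Proof.
rewrite !PsiGE => /toREL_eqP[a aE].
have {}aE u v : G u v -> delta D u v = delta C u v + a.
  move=> uv; have uvG : [set u; v] \in edges G by rewrite edgesE.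
  have := aE (exist _ [set u; v] uvG); rewrite !ffunE /=.
  rewrite !edge_val2 ?(gadj_neq uv) //; try exact: deltaC.
  by move=> E; lra.
(* Both products are nonnegative and each vanishes on some edge, so neither sign of [a] is
   possible. *)
have a0 : a = 0.
  have [u [v [uv C0]]] := delta_edge0 G_conn C.
  have [x [y [xy D0]]] := delta_edge0 G_conn D.
  have := aE u v uv; have := aE x y xy; rewrite C0 D0.
  have := delta_ge0 C x y; have := delta_ge0 D u v; lra.
by move=> u v /aE ->; rewrite a0 addr0.
Qed.

Lemma multipartite_PsiG_inj C D : complete_multipartite G ->
  gstable G C -> gstable G D -> PsiG G C = PsiG G D -> curve_iso C D.
Proof.
case=> P _ GE stC stD /PsiG_edge Gd; apply/delta_curve_iso/curve_ext => //.
suff le_d (A B : curve R I) : gstable G A -> (forall u v, G u v -> delta A u v = delta B u v) ->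
    forall i j, i != j -> delta A i j <= delta B i j.
  move=> i j ij; apply: le_anti; rewrite (le_d C D) //=.
  by apply: (le_d D C) => // u v uv; rewrite Gd.
move=> /gstableP/gst_delta st E i j ij.
have [Gij|nGij] := boolP (G i j); first by rewrite E.
have [d0|] := leP (delta A i j) 0; first exact: le_trans (delta_ge0 _ _ _).
move=> /(st i j ij)[u [w [uw iu iw]]].
have pij : pblock P i = pblock P j by apply/eqP; rewrite -[_ == _]negbK -GE.
(* The adjacent labels [u] and [w] lie in different parts, so one of them is adjacent to [i], hence
   also to [j] in the same part. The ultrametric inequality through it compares [A] with [B]. *)
have [x [Gix ix]] : exists x, G i x /\ delta A i j <= delta A i x.
  have [Giu|] := boolP (G i u); first by exists u.
  rewrite GE negbK => /eqP piu; exists w; split=> //.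
  by rewrite GE piu -GE.
have Gjx : G j x by rewrite GE -pij -GE.
have jx : delta A i j <= delta A j x.
  by apply: (@delta_ultra R I A _ j i x) => //; rewrite deltaC.
apply: (@delta_ultra R I B _ i x j); first by rewrite -E.
by rewrite [leRHS]deltaC -E.
Qed.

Section Cluster.
Variable S : {set I}.

(** One vertex beyond the root carries [S]: the label [x] outside [S] supplies the pair of product
    0, and the edge inside [S] supplies stability. *)
Lemma cluster_curve x y u w : x != y -> x \notin S -> G u w -> u \in S -> w \in S ->
  exists C, gstable G C /\
    forall i j, i != j -> delta C i j = ((i \in S) && (j \in S))%:R.
Proof.
move=> xy xS uw uS wS.
have [||||C CE] := @curve_of_ultrametric R I (fun i j => ((i \in S) && (j \in S))%:R).
- by move=> a b; rewrite andbC.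
- move=> r i j k _ + + _ _; case: (i \in S); case: (j \in S); case: (k \in S) => //=.
  by move=> r0 _; apply: le_trans r0 ler01.
- by move=> i j; rewrite ler0n.
- by exists x, y; rewrite (negPf xS).
exists C; split=> //; apply/gstableP/gst_delta => i j ij; rewrite CE //.
case: (boolP (i \in S)) => [iS|]; last by rewrite ltxx.
case: (boolP (j \in S)) => [jS _|]; last by rewrite ltxx.
exists u, w; rewrite uw.
suff H k : k \in S -> 1%:R <= delta C i k by split; rewrite ?H.
move=> kS; have [<-|ik] := eqVneq i k; last by rewrite CE // iS kS.
by apply: le_trans (delta_le_diag _ _ j); rewrite CE // iS jS.
Qed.

End Cluster.

Lemma PsiG_inj_multipartite :
  (forall C D, gstable G C -> gstable G D -> PsiG G C = PsiG G D -> curve_iso C D) ->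
  complete_multipartite G.
Proof.
move=> inj.
have tr u v w : ~~ G u v -> ~~ G v w -> ~~ G u w.
  move=> nuv nvw; apply/negP => uw.
  have uNv : u != v by apply: contraTneq uw => ->.
  have vNw : v != w by apply: contraTneq uw => <-.
  (* This neighbour lies outside [[set u; v; w]], so the larger cluster still leaves a label at the
     root. *)
  have [x vx] : exists x, G v x.
    have /connectP[[|x p] /=] := G_conn v u; first by move=> _ E; rewrite E eqxx in uNv.
    by case/andP=> vx _ _; exists x.
  have vS1 : v \notin [set u; w] by rewrite !inE negb_or eq_sym uNv.
  have xS2 : x \notin [set u; v; w].
    rewrite !inE !negb_or; apply/andP; split; [apply/andP; split|].
    - by apply: contraNneq nuv => <-; rewrite gadj_sym.
    - by rewrite eq_sym (gadj_neq vx).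
    - by apply: contraNneq nvw => <-.
  have xNv : x != v by rewrite eq_sym (gadj_neq vx).
  have vNu : v != u by rewrite eq_sym.
  have u2 : u \in [set u; v; w] by rewrite !inE eqxx.
  have v2 : v \in [set u; v; w] by rewrite !inE eqxx orbT.
  have w2 : w \in [set u; v; w] by rewrite !inE eqxx !orbT.
  have [C1 [st1 E1]] := cluster_curve vNu vS1 uw (set21 u w) (set22 u w).
  have [C2 [st2 E2]] := cluster_curve xNv xS2 uw u2 w2.
  (* Every edge at [v] leaves both clusters, so no edge of [G] tells the two products apart, whereas
     the pair of [u] and [v] does. *)
  have /(inj _ _ st1 st2)/curve_iso_delta/(_ u v) : PsiG G C1 = PsiG G C2.
    rewrite !PsiGE; congr (toREL (- _)); apply/ffunP; apply: edge_ind => a b abG ab.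
    have aNb := gadj_neq ab; rewrite !ffunE /= !edge_val2 //; try exact: deltaC.
    rewrite E1 // E2 //; congr (_%:R); congr nat_of_bool; rewrite !inE.
    have [av|aNv] := eqVneq a v.
      rewrite av in ab aNb *; rewrite (negPf vNu) (negPf vNw) /=.
      apply/esym/negbTE; rewrite !negb_or [b == v]eq_sym aNb /= andbT.
      by apply/andP; split; apply: contraTneq ab => ->; rewrite // gadj_sym.
    have [bv|bNv] := eqVneq b v; last by rewrite !orbF.
    rewrite bv in ab *; rewrite (negPf vNu) (negPf vNw) /= andbF orbF andbT.
    apply/esym/negbTE; rewrite negb_or.
    by apply/andP; split; apply: contraTneq ab => ->; rewrite // gadj_sym.
  rewrite E1 // E2 // u2 v2 !inE eqxx (negPf vNu) (negPf vNw) /=.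
  by move/eqP; rewrite eq_sym oner_eq0.
have eqv : {in [set: I] & &, equivalence_rel (fun u v => ~~ G u v)}.
  move=> u v w _ _ _; split; first by rewrite gadj_irr.
  move=> nuv; apply/idP/idP; last exact: tr.
  by apply: tr; rewrite gadj_sym.
exists (equivalence_partition (fun u v => ~~ G u v) setT).
  exact: equivalence_partitionP.
move=> u v; apply/negb_inj; rewrite negbK.
have /and3P[/eqP cov tI _] := equivalence_partitionP eqv.
by rewrite eq_pblock ?cov ?inE // pblock_equivalence_partition.
Qed.

Lemma identifies_multipartite :
  identifies (@PsiG R I G) (gstable G) (Bfan R G) <-> complete_multipartite G.
Proof.
split=> [[inj _ _]|mp].
  by apply: PsiG_inj_multipartite => C D stC stD; apply: (proj1 (inj C D stC stD)).
split=> [C D stC stD|C _|]; last exact: image_cones_Bfan.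
  split=> [|/curve_iso_delta]; last exact: PsiG_delta.
  exact: multipartite_PsiG_inj.
exact: PsiG_linear.
Qed.

End Identification.

(** * The fan of chains of flats *)

Section Cones.
Variables (R : realType) (I : finType) (G : sgraph I).
Hypothesis Gn0 : edges G != set0.
Implicit Types (c : seq {set {set I}}) (F H : {set {set I}}) (b : {set {set I}} -> R).

Definition cone c : set (REL R G) := conic (chain_gens R G c).

Lemma flat_chain_strict c : flat_chain G c -> strict_chain G c.
Proof. by case/(flat_chainP c Gn0). Qed.

Lemma flat_chain_flat c F : flat_chain G c -> F \in c -> flat G F.
Proof. by case/(flat_chainP c Gn0)=> _; apply. Qed.

Lemma flat_chain_uniq c : flat_chain G c -> uniq c.
Proof.
case/andP=> pc _; apply: (sorted_uniq _ _ (path_sorted pc)).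
  by move=> ? ? ?; apply: proper_trans.
by move=> ?; apply: properxx.
Qed.

Lemma flat_chain_filter c (Q : pred {set {set I}}) :
  flat_chain G c -> flat_chain G (filter Q c).
Proof.
move=> /andP[pc /allP fc]; apply/andP; split.
  apply: subseq_path (filter_subseq Q c) pc => A B D.
  exact: proper_trans.
by apply/allP => F; rewrite mem_filter => /andP[_ /fc].
Qed.

Lemma gens_sumE c (a : nat -> R) : uniq c ->
  \sum_(i < size (chain_gens R G c)) a i *: (chain_gens R G c)`_i =
  \sum_(F in c) a (index F c) *: rho R G F.
Proof.
move=> uc; rewrite -big_uniq // (big_nth set0) big_mkord size_map.
by apply: eq_bigr => i _; rewrite (nth_map set0) // index_uniq.
Qed.

Lemma coneP c x : uniq c -> cone c x <->
  exists2 b, (forall F, 0 <= b F) & x = \sum_(F in c) b F *: rho R G F.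
Proof.
move=> uc; split=> [[a a0 ->]|[b b0 ->]].
  by exists (fun F => a (index F c)); rewrite ?gens_sumE.
exists (fun i => b (nth set0 c i)) => //.
rewrite (gens_sumE (fun i => b (nth set0 c i))) //.
by apply: eq_bigr => F Fc; rewrite nth_index.
Qed.

Lemma sum_sub (V : nmodType) c c' (v : {set {set I}} -> V) : {subset c <= c'} ->
  (forall F, F \in c' -> F \notin c -> v F = 0) ->
  \sum_(F in c') v F = \sum_(F in c) v F.
Proof.
move=> sub v0; rewrite (bigID (mem c)) /= [X in _ + X]big1 ?addr0.
  by apply: eq_bigl => F; have := sub F; case: (F \in c) => [->|]; rewrite ?andbF.
by move=> F /andP[]; apply: v0.
Qed.

Lemma cone_mono c c' : uniq c -> uniq c' -> {subset c <= c'} ->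
  (cone c `<=` cone c')%classic.
Proof.
move=> uc uc' sub x /(coneP _ uc)[b b0 ->]; apply/(coneP _ uc').
exists (fun F => if F \in c then b F else 0); first by move=> F; case: ifP.
rewrite (sum_sub sub) => [|F _ /negPf ->]; last by rewrite scale0r.
by apply: eq_bigr => F ->.
Qed.

Lemma cone_rho c F : uniq c -> F \in c -> cone c (rho R G F).
Proof.
move=> uc Fc; apply/coneP => //; exists (fun H => (H == F)%:R) => [H|].
  by rewrite ler0n.
rewrite (bigD1 F) //= eqxx scale1r big1 ?addr0 // => H /andP[_ /negPf ->].
by rewrite scale0r.
Qed.

Lemma span_gensP c x : uniq c -> x \in <<chain_gens R G c>>%VS <->
  exists b, x = \sum_(F in c) b F *: rho R G F.
Proof.
move=> uc; split=> [xs|[b ->]].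
  pose X := in_tuple (chain_gens R G c).
  have /coord_span -> : x \in <<X>>%VS by [].
  pose a i := if insub i is Some j then coord X j x else 0.
  exists (fun F => a (index F c)); rewrite -(gens_sumE a) //.
  by apply: eq_bigr => i _; rewrite /a valK.
by apply: rpred_sum => F Fc; apply/rpredZ/memv_span/map_f.
Qed.

Lemma chain_coord c F : flat_chain G c -> F \in c -> exists f : 'Hom(REL R G, R^o),
  (forall H, H \in c -> f (rho R G H) = (H == F)%:R) /\
  (forall x, latticeREL R G x -> f x \is a Num.int).
Proof.
move=> flc Fc; have uc := flat_chain_uniq flc.
have [|f [fE fint]] := @chain_dual R I G c (flat_chain_strict flc) (index F c).
  by rewrite index_mem.
exists f; split=> // H Hc; rewrite -{1}(nth_index set0 Hc) fE ?index_mem //.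
by congr (_%:R); congr nat_of_bool; apply/eqP/eqP => [/(congr1 (nth set0 c))|->//];
  rewrite !nth_index.
Qed.

Lemma coord_sum c F (f : 'Hom(REL R G, R^o)) b :
  (forall H, H \in c -> f (rho R G H) = (H == F)%:R) -> F \in c ->
  f (\sum_(H in c) b H *: rho R G H) = b F.
Proof.
move=> fE Fc; rewrite linear_sum (eq_bigr (fun H => b H * (H == F)%:R)) /=.
  rewrite (bigD1 F) //= eqxx mulr1 big1 ?addr0 // => H /andP[_ /negPf ->].
  by rewrite mulr0.
by move=> H Hc; rewrite linearZ /= fE.
Qed.

Lemma cone_free c : flat_chain G c -> \dim <<chain_gens R G c>> = size c.
Proof.
move=> flc; have uc := flat_chain_uniq flc; rewrite -(size_map (rho R G) c).
apply/eqP; rewrite -[_ == _]/(free (chain_gens R G c)).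
apply/(freeP (X := in_tuple (chain_gens R G c))) => k.
pose a i := if insub i is Some j then k j else 0.
rewrite (eq_bigr (fun i : 'I_(size (chain_gens R G c)) =>
  a i *: (chain_gens R G c)`_i)) => [|i _]; last by rewrite /a valK.
rewrite gens_sumE // => E i.
have ic : (i < size c)%N by rewrite -(size_map (rho R G) c).
have Fc : nth set0 c i \in c by apply: mem_nth.
have [f [fE _]] := chain_coord flc Fc.
have := coord_sum (fun F => a (index F c)) fE Fc.
by rewrite E linear0 index_uniq // /a valK => <-.
Qed.

Lemma lhull_cone c : flat_chain G c -> lhull (cone c) = <<chain_gens R G c>>%VS.
Proof.
move=> flc; have uc := flat_chain_uniq flc.
have inS x : cone c x -> x \in <<chain_gens R G c>>%VS.
  by move=> /(coneP _ uc)[b _ ->]; apply/span_gensP => //; exists b.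
have minS (W : {vspace REL R G}) : (forall x, cone c x -> x \in W) ->
    (<<chain_gens R G c>> <= W)%VS.
  by move=> H; apply/span_subvP => _ /mapP[F Fc ->]; apply/H/cone_rho.
rewrite /lhull; case: xgetP => [U _ [U1 U2]|/(_ <<chain_gens R G c>>%VS)[]]; last first.
  by split.
by apply/eqP; rewrite eqEsubv U2 //= minS.
Qed.

Lemma cdim_cone c : flat_chain G c -> cdim (cone c) = size c.
Proof. by move=> flc; rewrite /cdim lhull_cone // cone_free. Qed.

Lemma face_filter c (Q : pred {set {set I}}) : flat_chain G c ->
  face (cone (filter Q c)) (cone c).
Proof.
move=> flc; have uc := flat_chain_uniq flc; have uQ := filter_uniq Q uc.
have ex F : exists f : 'Hom(REL R G, R^o), F \in c ->
    forall H, H \in c -> f (rho R G H) = (H == F)%:R.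
  have [Fc|] := boolP (F \in c); last by exists 0.
  by have [f [fE _]] := chain_coord flc Fc; exists f.
have [f fE] := boolp.choice ex.
(* The sum of the coordinates at the omitted flats: nonnegative on the cone, and zero exactly on the
   smaller cone. *)
pose g := (\sum_(F in c | ~~ Q F) f F)%R.
have gE b : g (\sum_(H in c) b H *: rho R G H) = \sum_(F in c | ~~ Q F) b F.
  rewrite sum_lfunE; apply: eq_bigr => F /andP[Fc _].
  exact: coord_sum (fE F Fc) Fc.
exists g; first by move=> x /(coneP _ uc)[b b0 ->]; rewrite gE sumr_ge0.
apply/seteqP; split=> x /=.
  move=> xQ; split; first by apply: cone_mono xQ => // F; rewrite mem_filter => /andP[].
  have /(coneP _ uQ)[b b0 ->] := xQ; rewrite linear_sum big1 // => H.
  rewrite mem_filter => /andP[QH Hc]; rewrite linearZ /= sum_lfunE big1 ?scaler0 //.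
  move=> F /andP[Fc nQF]; rewrite fE //; case: eqP => // HF.
  by rewrite HF (negPf nQF) in QH.
case=> /(coneP _ uc)[b b0 ->]; rewrite gE => /eqP.
rewrite psumr_eq0 // => /allP b0Q; apply/coneP => //; exists b => //.
apply: sum_sub => [F|F Fc]; rewrite mem_filter; first by case/andP.
rewrite Fc andbT => nQF; have /implyP := b0Q F (mem_index_enum F).
by rewrite Fc nQF => /(_ isT)/eqP ->; rewrite scale0r.
Qed.

(** A sum of nonnegative terms vanishes only if each term does, so a face is spanned by the
    generators killed by its functional. *)
Lemma face_cone c t : flat_chain G c -> face t (cone c) ->
  exists2 c', flat_chain G c' & t = cone c'.
Proof.
move=> flc [f f0 ->]; have uc := flat_chain_uniq flc.
pose Q F := f (rho R G F) == 0; have uQ := filter_uniq Q uc.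
exists (filter Q c); first exact: flat_chain_filter.
apply/seteqP; split=> x /=.
  case=> /(coneP _ uc)[b b0 ->]; rewrite linear_sum /= => /eqP.
  rewrite psumr_eq0 => [/allP fb|F Fc]; last first.
    by rewrite linearZ; apply: mulr_ge0 => //; apply/f0/cone_rho.
  apply/coneP => //; exists b => //.
  apply: sum_sub => [F|F Fc]; rewrite mem_filter; first by case/andP.
  rewrite Fc andbT => nQF; have /implyP := fb F (mem_index_enum F) => /(_ Fc).
  rewrite linearZ /= mulf_eq0 (negPf nQF : (f (rho R G F) == 0) = false) orbF.
  by move=> /eqP ->; rewrite scale0r.
move=> xQ; split; first by apply: cone_mono xQ => // F; rewrite mem_filter => /andP[].
have /(coneP _ uQ)[b b0 ->] := xQ; rewrite linear_sum big1 // => H.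
by rewrite mem_filter => /andP[/eqP QH Hc]; rewrite linearZ /= QH scaler0.
Qed.

Lemma sum_rhoE c b : \sum_(F in c) b F *: rho R G F =
  toREL (- \sum_(F in c) b F *: indic R G F).
Proof.
rewrite -sumrN linear_sum; apply: eq_bigr => F _ /=.
by rewrite rhoE -scalerN linearZ.
Qed.

(* A flat of positive weight is a level set of the weighted sum of the
   indicators, which determines it. *)
Lemma cone_carrier c c' b b' F : flat_chain G c -> flat_chain G c' ->
  (forall H, 0 <= b H) -> (forall H, 0 <= b' H) ->
  \sum_(H in c) b H *: rho R G H = \sum_(H in c') b' H *: rho R G H ->
  F \in c -> 0 < b F -> F \in c'.
Proof.
move=> flc flc' b0 b0' E Fc bF.
pose g (e : {set I}) := \sum_(H in c) b H * (e \in H)%:R.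
pose g' (e : {set I}) := \sum_(H in c') b' H * (e \in H)%:R.
have [a gg'] : exists a, forall e : edge_of G, g (val e) = g' (val e) + a.
  move: E; rewrite !sum_rhoE => /toREL_eqP[a aE]; exists (- a) => e.
  have {aE} := aE e; rewrite !ffunE !sum_ffunE.
  rewrite (eq_bigr (fun H => b H * (val e \in H)%:R)) => [|H _]; last by rewrite !ffunE.
  rewrite -/(g _) [in X in _ = X -> _](eq_bigr (fun H => b' H * (val e \in H)%:R)).
    by rewrite -/(g' _) => E; lra.
  by move=> H _; rewrite !ffunE.
have sc := flat_chain_strict flc; have sc' := flat_chain_strict flc'.
have FG := flat_sub (flat_chain_flat flc Fc).
have g_lt e f : e \in F -> f \notin F -> g f < g e.
  move=> eF fF; rewrite /g (bigD1 F) // [ltRHS](bigD1 F) //= eF (negPf fF).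
  rewrite mulr0 add0r mulr1 -[ltLHS]add0r ltr_leD //; apply: ler_sum => H /andP[Hc HF].
  rewrite ler_wpM2l // ler_nat; case fH: (f \in H) => //.
  case/orP: (chain_total sc Fc Hc) => /subsetP sub; first by rewrite sub.
  by rewrite sub in fF.
pose lev (e : {set I}) := find (fun H => e \in H) c'.
have g'_le e f : (lev f <= lev e)%N -> g' e <= g' f.
  move=> le_ef; apply: ler_sum => H Hc'; rewrite ler_wpM2l // ler_nat.
  case eH: (e \in H) => //; rewrite -(nth_index set0 Hc') in eH *.
  have iH : (index H c' < size c')%N by rewrite index_mem.
  rewrite (chain_levelE sc' _ iH) in eH.
  by rewrite (chain_levelE sc' _ iH) (leq_trans le_ef).
have [e0 e0F] : exists e, e \in F.
  apply/set0Pn; have /andP[pc _] := flc.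
  have := order_path_min (fun B A C : {set {set I}} => @proper_trans _ A B C) pc.
  by move=> /allP/(_ F Fc); rewrite proper0.
(* Among the elements of [F], take one that enters [c'] last; the flat in which it enters turns out
   to be [F]. *)
case: (@arg_maxnP _ e0 (fun e => e \in F) lev e0F) => e eF max_e.
have FE f : f \in edges G -> (f \in F) = (lev f <= lev e)%N.
  move=> fG; apply/idP/idP => [|le_fe]; first exact: max_e.
  apply: contraTT (g'_le e f le_fe) => fF; rewrite -ltNge.
  have := g_lt e f eF fF.
  rewrite (gg' (exist _ f fG)) (gg' (exist _ e (subsetP FG _ eF))).
  by rewrite ltrD2r.
have le_c : (lev e < size c')%N.
  rewrite ltnNge; apply/negP => ge_c.
  have /andP[_ /allP/(_ F Fc)/andP[_ /properP[_ [f fG]]]] := flc.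
  by rewrite FE // (leq_trans _ ge_c) // find_size.
have -> : F = nth set0 c' (lev e); last exact: mem_nth.
have LG := flat_sub (flat_chain_flat flc' (mem_nth set0 le_c)).
apply/setP => f; have [fG|fNG] := boolP (f \in edges G).
  by rewrite FE // (chain_levelE sc').
by apply/idP/idP => [/(subsetP FG)|/(subsetP LG)]; rewrite (negPf fNG).
Qed.

Lemma cone_mem c F : flat_chain G c -> flat_chain G [:: F] -> cone c (rho R G F) -> F \in c.
Proof.
move=> flc flF /(coneP _ (flat_chain_uniq flc))[b b0 E].
apply: (cone_carrier (b := fun=> 1) flF flc _ b0 _ (mem_head _ _) ltr01).
  by move=> H; apply: ler01.
by rewrite -E -big_uniq //= big_seq1 scale1r.
Qed.

Lemma flat_chain1 c F : flat_chain G c -> F \in c -> flat_chain G [:: F].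
Proof.
move=> /andP[pc /allP flc] Fc; apply/andP; rewrite /= flc // !andbT; split=> //.
have := order_path_min (fun B A C : {set {set I}} => @proper_trans _ A B C) pc.
by move=> /allP/(_ F Fc).
Qed.

Lemma cone_subP c c' : flat_chain G c -> flat_chain G c' ->
  (cone c `<=` cone c')%classic <-> {subset c <= c'}.
Proof.
move=> flc flc'; have uc := flat_chain_uniq flc.
split=> [sub F Fc|]; last by apply: cone_mono => //; apply: flat_chain_uniq.
apply: cone_mem => //; first exact: flat_chain1 Fc.
exact/sub/cone_rho.
Qed.

(** A flat with positive coefficient in a common point belongs to both chains, by [cone_carrier]. *)
Lemma coneI c c' : flat_chain G c -> flat_chain G c' ->
  (cone c `&` cone c')%classic = cone (filter (mem c') c).
Proof.
move=> flc flc'; have [uc uc'] := (flat_chain_uniq flc, flat_chain_uniq flc').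
have um := filter_uniq (mem c') uc.
apply/seteqP; split=> x; last first.
  move=> xm; split; apply: cone_mono xm => // F; rewrite mem_filter => /andP[] //.
case=> /(coneP _ uc)[b b0 ->] /(coneP _ uc')[b' b0' E].
apply/coneP => //; exists b => //.
apply: sum_sub => [F|F Fc]; rewrite mem_filter; first by case/andP.
rewrite Fc andbT => FNc'; suff -> : b F = 0 by rewrite scale0r.
apply: contraNeq FNc' => bF; apply: (cone_carrier flc flc' b0 b0' E Fc).
by rewrite lt_neqAle eq_sym bF b0.
Qed.

Lemma Bfan_is_fan : is_fan (latticeREL R G) (Bfan R G).
Proof.
have coneE c : conic [seq rho R G F | F <- c] = cone c by [].
split.
- rewrite /Bfan; apply: finite_image.
  pose N := #|{: {set {set I}}}|.
  apply: (@sub_finite_set _ _ ((fun s : N.-bseq {set {set I}} => val s) @` classical_sets.setT)%classic);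
    last exact/finite_image/finite_finset.
  move=> c /= flc; have cN : (size c <= N)%N.
    by have /card_uniqP <- := flat_chain_uniq flc; apply: max_card.
  by exists (Bseq cN).
- move=> _ [c flc <-]; exists [seq rho R G F | F <- c] => // _ /mapP[F _ ->].
  exists (- indic R G F); last by rewrite rhoE.
  by move=> e; rewrite !ffunE rpredN; apply: rpred_nat.
- move=> _ t [c flc <-]; rewrite coneE => /(face_cone flc)[c' flc' ->].
  by exists c'.
- move=> _ _ [c flc <-] [c' flc' <-]; rewrite !coneE; split.
    by rewrite coneI //; apply: face_filter.
  by rewrite classical_sets.setIC coneI //; apply: face_filter.
Qed.

End Cones.

(** * Balancing *)

Section Balanced.
Variables (R : realType) (I : finType) (G : sgraph I).
Hypothesis Gn0 : edges G != set0.
Implicit Types (c p q : seq {set {set I}}) (A B F H : {set {set I}}).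

Local Notation rk := (mrank (edges G)).
Local Notation prop_path := (path (fun A B : {set {set I}} => A \proper B)).
Local Notation cone := (@cone R I G).

(** A chain with too few flats skips a rank somewhere, and there the flat generated by one more edge
    fits strictly between its neighbours. *)
Lemma chain_refine A c : prop_path A (rcons c (edges G)) ->
  (forall F, F \in A :: c -> flat G F) -> (mrank A + size c + 1 < rk)%N ->
  exists c', [/\ prop_path A (rcons c' (edges G)), forall F, F \in A :: c' -> flat G F,
    size c' = (size c).+1 & {subset c <= c'}].
Proof.
have insert F B : flat G F -> flat G B -> F \proper B -> (mrank F + 1 < mrank B)%N ->
    exists H, [/\ flat G H, F \proper H & H \proper B].
  move=> flF flB /properP[FB [e eB eF]] rFB.
  have [flC FC _ CB rC] := flat_cover flF flB FB eB eF.
  exists (closure G (e |: F)); split=> //.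
  by rewrite properEneq CB andbT; apply: contraTneq rFB => <-; rewrite rC addn1 ltnn.
elim: c A => [|B c IH] A /=.
  rewrite andbT addn0 => AE fl rA.
  have [H [flH AH HE]] := insert A _ (fl A (mem_head _ _)) (flat_edges G) AE rA.
  exists [:: H]; rewrite /= AH HE; split=> // F; rewrite !inE => /orP[/eqP->|/eqP->] //.
  by apply: fl; rewrite inE.
case/andP=> AB Bc fl; have flA : flat G A by apply: fl; rewrite mem_head.
have flB : flat G B by apply: fl; rewrite !inE eqxx orbT.
have [rAB rk_lt|] := ltnP (mrank A + 1) (mrank B).
  have [H [flH AH HB]] := insert A B flA flB AB rAB.
  exists [:: H, B & c]; rewrite /= AH HB Bc; split=> // F.
    by rewrite inE => /orP[/eqP ->//|]; rewrite inE => /orP[/eqP ->//|Fc];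
      apply: fl; rewrite inE Fc orbT.
  by rewrite !inE => /orP[->|->]; rewrite ?orbT.
move=> rBA rk_lt; have [||c' [pc' flc' szc' sub]] := IH B Bc.
- by move=> F Fc; apply: fl; rewrite inE Fc orbT.
- lia.
exists (B :: c'); rewrite /= AB pc' szc'; split=> // F.
  by rewrite inE => /orP[/eqP ->//|]; apply: flc'.
by rewrite !inE => /orP[->//|/sub ->]; rewrite orbT.
Qed.

Lemma chain_rank_lt A c : prop_path A (rcons c (edges G)) ->
  (forall F, F \in A :: c -> flat G F) -> (mrank A + size c < rk)%N.
Proof.
elim: c A => [|B c IH] A /=.
  rewrite andbT addn0 => AE fl; apply: mrank_flat_proper AE; last exact: flat_edges.
  by apply: fl; rewrite mem_head.
case/andP=> AB Bc fl; have flB F : F \in B :: c -> flat G F.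
  by move=> Fc; apply: fl; rewrite inE Fc orbT.
have : (mrank A < mrank B)%N.
  by apply: mrank_flat_proper AB; [apply: fl|apply: flB]; exact: mem_head.
have := IH B Bc flB; lia.
Qed.

Lemma flat_chainE c : flat_chain G c <-> prop_path set0 (rcons c (edges G)) /\
  (forall F, F \in set0 :: c -> flat G F).
Proof.
apply: (iff_trans (flat_chainP c Gn0)); split=> -[pc fl]; split=> // F.
  by rewrite inE => /orP[/eqP ->|]; [exact: flat0|exact: fl].
by move=> Fc; apply: fl; rewrite inE Fc orbT.
Qed.

Lemma size_flat_chain c : flat_chain G c -> (size c < rk)%N.
Proof. by case/flat_chainE=> pc fl; have := chain_rank_lt pc fl; rewrite mrank0. Qed.

Lemma flat_chain_extend c : flat_chain G c ->
  exists c', [/\ flat_chain G c', size c' = rk.-1 & {subset c <= c'}].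
Proof.
have [n] := ubnP (rk - size c); elim: n c => // n IH c le_n flc.
have szc := size_flat_chain flc.
have [lt_c|ge_c] := ltnP (size c + 1) rk; last first.
  by exists c; split=> //; lia.
have [pc fl] := proj1 (flat_chainE c) flc.
have [|c' [pc' flc' szc' sub]] := chain_refine pc fl; first by rewrite mrank0 add0n.
have [||c'' [? ? sub']] := IH c'.
- lia.
- exact/flat_chainE.
by exists c''; split=> // F /sub/sub'.
Qed.

(** The flats of a maximal chain have the ranks strictly between those of [set0] and [edges G],
    hence the dimension [rk.-1]. *)
Lemma Bfan_pure : pure rk.-1 (Bfan R G).
Proof.
move=> _ [c flc <-]; have [c' [flc' szc' sub]] := flat_chain_extend flc.
exists (cone c'); last by apply/(cone_subP R Gn0 flc flc').
by split; [exists c'|rewrite cdim_cone].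
Qed.

Lemma chain_rank_eq A c : prop_path A (rcons c (edges G)) ->
  (forall F, F \in A :: c -> flat G F) -> (mrank A + size c).+1 = rk ->
  forall i, (i < size c)%N -> mrank (nth set0 c i) = (mrank A + i).+1.
Proof.
elim: c A => [|B c IH] A //= /andP[AB Bc] fl E.
have flB F : F \in B :: c -> flat G F.
  by move=> Fc; apply: fl; rewrite inE Fc orbT.
have rAB : (mrank A < mrank B)%N.
  by apply: mrank_flat_proper AB; [apply: fl|apply: flB]; exact: mem_head.
have := chain_rank_lt Bc flB => rBA.
have rB : mrank B = (mrank A).+1 by lia.
case=> [|i] ic; first by rewrite addn0.
by rewrite /= (IH B Bc flB) //; lia.
Qed.

(* The size condition says that the chain misses exactly one rank. *)
Lemma chain_gap A c : prop_path A (rcons c (edges G)) ->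
  (forall F, F \in A :: c -> flat G F) -> (mrank A + size c).+2 = rk ->
  exists p q, [/\ c = p ++ q, mrank (last A p) = (mrank A + size p)%N
    & mrank (head (edges G) q) = (mrank A + size p).+2].
Proof.
elim: c A => [|B c IH] A /=.
  by move=> _ _ E; exists [::], [::]; rewrite /= -E !addn0.
move=> /andP[AB Bc] fl E.
have flB F : F \in B :: c -> flat G F.
  by move=> Fc; apply: fl; rewrite inE Fc orbT.
have rAB : (mrank A < mrank B)%N.
  by apply: mrank_flat_proper AB; [apply: fl|apply: flB]; exact: mem_head.
have rBA := chain_rank_lt Bc flB.
have [rB|rB] := eqVneq (mrank B) (mrank A).+1.
  have [|p [q [-> rp rq]]] := IH B Bc flB; first by lia.
  by exists (B :: p), q; rewrite /= rp rq rB addnS.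
exists [::], (B :: c); rewrite /= addn0; split=> //.
by move/eqP in rB; lia.
Qed.

Lemma rho0 : rho R G set0 = 0.
Proof.
rewrite rhoE (_ : indic R G set0 = 0) ?oppr0 ?linear0 //.
by apply/ffunP => e; rewrite !ffunE inE.
Qed.

Lemma rho_edges : rho R G (edges G) = 0.
Proof.
rewrite rhoE -(toREL_cst G (-1)); congr toREL.
by apply/ffunP => e; rewrite !ffunE (valP e).
Qed.

Section Codim1.
Variables (p q : seq {set {set I}}).
Local Notation c := (p ++ q).
Local Notation A := (last set0 p).
Local Notation B := (head (edges G) q).
Hypotheses (flc : flat_chain G c) (rA : mrank A = size p)
  (rB : mrank B = (size p).+2) (rE : (size c).+2 = rk).

(** The ranks of [A] and [B] differ by two, so these are the flats of the missing rank, the covers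
    of [A] inside [B]. *)
Definition between : {set {set {set I}}} :=
  [set F | [&& flat G F, A \proper F & F \proper B]].

Definition refine F := p ++ F :: q.

Let pathc : prop_path set0 (rcons c (edges G)) := proj1 (proj1 (flat_chainE c) flc).
Let flatc F : F \in set0 :: c -> flat G F := proj2 (proj1 (flat_chainE c) flc) F.

Lemma flatA : flat G A.
Proof.
apply: flatc; have := mem_last set0 p; rewrite !inE mem_cat => /orP[->//|->].
by rewrite orbT.
Qed.

Lemma flatB : flat G B.
Proof.
case: {+}q flatc => [|H r] /= fl; first exact: flat_edges.
by apply: fl; rewrite inE mem_cat mem_head !orbT.
Qed.

Lemma properAB : A \proper B.
Proof.
move: pathc; rewrite rcons_cat cat_path => /andP[_].
by case: {+}q => [|H r] /= /andP[].
Qed.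

Lemma between_rank F : F \in between -> mrank F = (size p).+1.
Proof.
rewrite inE => /and3P[flF AF FB].
have := mrank_flat_proper flatA flF AF; have := mrank_flat_proper flF flatB FB.
by rewrite rA rB; clear; lia.
Qed.

Lemma flat_chain_refine F : F \in between -> flat_chain G (refine F).
Proof.
rewrite inE => /and3P[flF AF FB]; apply/flat_chainE; split; last first.
  move=> H; rewrite inE mem_cat inE => /or4P[/eqP ->|Hp|/eqP ->//|Hq].
  - exact: flat0.
  - by apply: flatc; rewrite inE mem_cat Hp orbT.
  - by apply: flatc; rewrite inE mem_cat Hq !orbT.
move: pathc; rewrite /refine !rcons_cat !cat_path /= => /andP[-> /=].
rewrite AF /=; case: {+}q FB => [|H r] /=; first by move=> ->.
by move=> -> /andP[_ ->].
Qed.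

Lemma mem_refine F H : (H \in refine F) = (H == F) || (H \in c).
Proof. by rewrite !mem_cat inE orbCA. Qed.

Lemma between_notin F : F \in between -> F \notin c.
Proof.
move=> FT; have := flat_chain_uniq (flat_chain_refine FT).
rewrite /refine -cat1s uniq_catCA /= => /andP[].
by rewrite mem_cat.
Qed.

(** A maximal chain has one flat of each rank, so the flat it adds to [c] has the missing rank and
    its position is forced. *)
Lemma refine_ex c' : flat_chain G c' -> size c' = rk.-1 -> {subset c <= c'} ->
  exists2 F, F \in between & cone c' = cone (refine F).
Proof.
move=> flc' szc' sub; have uc := flat_chain_uniq flc; have uc' := flat_chain_uniq flc'.
have [F Fc' FNc] : exists2 F, F \in c' & F \notin c.
  apply/hasP; rewrite -[has _ _]negbK -all_predC; apply/allP => sub'.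
  have : (size c' <= size c)%N.
    by apply: uniq_leq_size => // H /sub' /=; rewrite negbK.
  by rewrite szc' -rE /= ltnn.
have [pc' fl'] := proj1 (flat_chainE c') flc'.
have rk' i : (i < size c')%N -> mrank (nth set0 c' i) = i.+1.
  by move=> ic; rewrite (chain_rank_eq pc' fl') ?mrank0 // szc' -rE.
have rk_mem H : H \in c' -> mrank H = (index H c').+1.
  by move=> Hc'; rewrite -{1}(nth_index set0 Hc') rk' // index_mem.
have sc' := flat_chain_strict Gn0 flc'.
have lt_sub H K : H \in c' -> K \in c' -> (mrank H < mrank K)%N -> H \proper K.
  move=> Hc' Kc' lt_HK; rewrite properEneq; apply/andP; split.
    by apply: contraTneq lt_HK => ->; rewrite ltnn.
  case/orP: (chain_total sc' Hc' Kc') => // KH.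
  by have := mrankS KH; rewrite leqNgt lt_HK.
have FG : F \proper edges G by have /andP[_ /allP/(_ F Fc')/andP[]] := flc'.
have F0 : set0 \proper F.
  by have /andP[/andP[]] := flat_chain1 flc' Fc'.
have AE : A = set0 \/ A \in c'.
  have := mem_last set0 p; rewrite inE => /orP[/eqP ->|Ap]; [by left|right].
  by apply: sub; rewrite mem_cat Ap.
have BE : B = edges G \/ B \in c'.
  case Eq: {+}q => [|H r] /=; [by left|right].
  by apply: sub; rewrite mem_cat Eq mem_head orbT.
have rp H : H \in p -> (mrank H <= size p)%N.
  move=> Hp; rewrite -rA mrankS //; apply: chain_last_sub; last by rewrite inE Hp orbT.
  by move: pathc; rewrite rcons_cat cat_path => /andP[].
have rq H : H \in q -> ((size p).+2 <= mrank H)%N.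
  move: pathc; rewrite rcons_cat cat_path => /andP[_].
  case: {+}q rB => [|K r] //= <- /andP[_]; rewrite rcons_path => /andP[Kr _].
  rewrite inE => /orP[/eqP -> //|Hr]; apply/mrankS/proper_sub.
  have := order_path_min (fun B A C : {set {set I}} => @proper_trans _ A B C) Kr.
  by move=> /allP/(_ H Hr).
have [up uq] : uniq p /\ uniq q by move: uc; rewrite cat_uniq => /and3P[].
(* By cardinality [p] exhausts the flats of [c'] of rank at most [size p], and [q] those of rank at
   least [(size p).+2]. *)
have p_take : p =i take (size p) c'.
  have [||_ //] := uniq_min_size (s2 := take (size p) c') up.
    move=> H Hp; have Hc' : H \in c' by apply: sub; rewrite mem_cat Hp.
    by rewrite in_take //; have := rp H Hp; rewrite rk_mem.
  by rewrite size_take; case: ltnP.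
have q_drop : q =i drop (size p).+1 c'.
  have [||_ //] := uniq_min_size (s2 := drop (size p).+1 c') uq.
    move=> H Hq; have Hc' : H \in c' by apply: sub; rewrite mem_cat Hq orbT.
    have := Hc'; rewrite -{1}(cat_take_drop (size p).+1 c') mem_cat in_take //.
    by case/orP => // iH; have := rq H Hq; rewrite rk_mem // ltnS leqNgt iH.
  by rewrite size_drop szc' -rE size_cat /= subSS addKn.
have rF : mrank F = (size p).+1.
  rewrite rk_mem //; congr S; apply/eqP; rewrite eqn_leq; apply/andP; split.
    rewrite leqNgt; apply: contraNN FNc => iF; rewrite mem_cat q_drop.
    have := Fc'; rewrite -{1}(cat_take_drop (size p).+1 c') mem_cat in_take //.
    by case/orP => [|->]; [rewrite ltnS leqNgt iF|rewrite orbT].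
  rewrite leqNgt; apply: contraNN FNc => iF.
  by rewrite mem_cat p_take in_take // iF.
have FT : F \in between.
  rewrite inE (flat_chain_flat Gn0 flc' Fc') /=; apply/andP; split.
    by case: AE => [->//|Ac']; apply: lt_sub => //; rewrite rA rF.
  by case: BE => [->//|Bc']; apply: lt_sub => //; rewrite rB rF.
exists F => //; have flr := flat_chain_refine FT; have ur := flat_chain_uniq flr.
have sub' : {subset refine F <= c'}.
  by move=> H; rewrite mem_refine => /orP[/eqP ->|/sub].
have [|_ E] := uniq_min_size ur sub'.
  by rewrite szc' -rE /refine !size_cat /= addnS.
by apply/seteqP; split; apply: cone_mono => // H; rewrite E.
Qed.

Lemma refine_inj F H : F \in between -> H \in between ->
  cone (refine F) = cone (refine H) -> F = H.
Proof.
move=> FT HT E; have [flF flH] := (flat_chain_refine FT, flat_chain_refine HT).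
have : {subset refine F <= refine H}.
  by apply/(cone_subP R Gn0 flF flH); rewrite E.
move=> /(_ F); rewrite !mem_refine eqxx => /(_ isT)/orP[/eqP //|].
by rewrite (negPf (between_notin FT)).
Qed.

(** The dual functional of [F] is integral on the lattice, so the coefficient of [rho R G F] in a
    lattice point is an integer. This makes the generator a primitive normal vector. *)
Lemma span_refine F x : F \in between -> x \in <<chain_gens R G (refine F)>>%VS ->
  latticeREL R G x ->
  exists k : int, x - rho R G F *~ k \in <<chain_gens R G c>>%VS.
Proof.
move=> FT xs xL; have flr := flat_chain_refine FT.
have Fr : F \in refine F by rewrite mem_refine eqxx.
have [f [fE fint]] := chain_coord R Gn0 flr Fr.
have := fint x xL; case/(span_gensP _ (flat_chain_uniq flr)): xs => b -> {x xL}.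
rewrite (coord_sum _ fE Fr) => /intrP[k bk]; exists k.
rewrite (bigD1 F) //= bk scaler_int addrAC subrr add0r.
apply: rpred_sum => H; rewrite mem_refine => /andP[/orP[->//|Hc] _].
exact/rpredZ/memv_span/map_f.
Qed.

(** Compared edge by edge: an edge of [A] lies in all the covers, an edge of [B] outside [A] in
    exactly one, other edges in none. The 1 subtracted is the share of [A] already contained in
    [B]. *)
Lemma sum_between : \sum_(F in between) rho R G F =
  (#|between|%:R - 1) *: rho R G A + rho R G B.
Proof.
rewrite !rhoE -linearZ -linearD /=.
under eq_bigr do rewrite rhoE; rewrite -linear_sum /=; congr toREL.
apply/ffunP => e; rewrite sum_ffunE !ffunE /GRing.scale /=.
under eq_bigr do rewrite !ffunE; rewrite sumrN.
have [eA|eNA] := boolP (val e \in A).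
  rewrite (subsetP (proper_sub properAB)) //.
  rewrite (eq_bigr (fun=> 1)) => [|F]; first by rewrite sumr_const mulrN1 opprB addrAC subrr add0r.
  by rewrite inE => /and3P[_ /proper_sub/subsetP/(_ _ eA) -> _].
have [eB|eNB] := boolP (val e \in B); last first.
  rewrite big1 ?oppr0 ?mulr0 ?addr0 // => F; rewrite inE => /and3P[_ _ /proper_sub FB].
  by rewrite (contraNF (subsetP FB _) eNB).
have [flC AC eC CB rC] := flat_cover flatA flatB (proper_sub properAB) eB eNA.
have CT : closure G (val e |: A) \in between.
  rewrite inE flC AC properEneq CB andbT /=; apply/eqP => E.
  by move: rC; rewrite E rA rB => /esym/n_Sn.
rewrite (bigD1 _ CT) /= eC big1 ?addr0 ?oppr0 ?mulr0 ?add0r // => F /andP[FT FNC].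
case eF : (val e \in F) => //; case/eqP: FNC.
have {}FT : F \in between by [].
have := FT; rewrite inE => /and3P[flF AF _].
by apply: (flat_cover_uniq flatA flF (proper_sub AF) eF eNA); rewrite rA between_rank.
Qed.

Lemma sum_between_span :
  \sum_(F in between) rho R G F \in <<chain_gens R G c>>%VS.
Proof.
(* At the ends of the chain [A] may be [set0] and [B] may be [edges G]; their vectors are zero. *)
rewrite sum_between; apply: rpredD.
  apply: rpredZ; have := mem_last set0 p; rewrite inE => /orP[/eqP ->|Ap].
    by rewrite rho0 rpred0.
  by apply/memv_span/map_f; rewrite mem_cat Ap.
case Eq : q => [|H r] /=; first by rewrite rho_edges rpred0.
by apply/memv_span/map_f; rewrite mem_cat mem_head orbT.
Qed.

Lemma codim1_balanced : exists2 u : set (REL R G) -> REL R G,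
  forall s, Bfan R G s -> cdim s = rk.-1 -> (cone c `<=` s)%classic ->
    primitive_normal (latticeREL R G) (cone c) s (u s) &
  \sum_(s \in [set s | [/\ Bfan R G s, cdim s = rk.-1 & cone c `<=` s]]%classic)
    u s *+ 1 \in lhull (cone c).
Proof.
(* Normal vectors are indexed by cones, so the added flat is recovered from the cone, uniquely by
   [refine_inj]; [set0] is the default elsewhere. *)
pose u (s : set (REL R G)) : REL R G :=
  rho R G (odflt set0 [pick F | (F \in between) && `[< s = cone (refine F) >]]).
have uE F : F \in between -> u (cone (refine F)) = rho R G F.
  move=> FT; rewrite /u; case: pickP => [H /andP[HT /asboolP E]|/(_ F)] /=.
    by rewrite (refine_inj FT HT E).
  by rewrite FT /= => /asboolP.
have tops s : [/\ Bfan R G s, cdim s = rk.-1 & (cone c `<=` s)%classic] <->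
    exists2 F, F \in between & s = cone (refine F).
  split=> [[[c' flc' <-]]|[F FT ->]].
    rewrite -/(cone c') cdim_cone // => sz /(cone_subP R Gn0 flc flc') sub.
    exact: refine_ex.
  have flr := flat_chain_refine FT; split; first by exists (refine F).
    by rewrite cdim_cone // -rE /refine !size_cat /= addnS.
  by apply/(cone_subP R Gn0 flc flr) => H Hc; rewrite mem_refine Hc orbT.
exists u => [s Bs ds ts|].
  have [F FT ->] := proj1 (tops s) (And3 Bs ds ts).
  have flr := flat_chain_refine FT; rewrite uE //; split.
  - exists (- indic R G F); last by rewrite rhoE.
    by move=> e; rewrite !ffunE rpredN; apply: rpred_nat.
  - by apply: cone_rho; [exact: flat_chain_uniq flr|rewrite mem_refine eqxx].
  - by move=> x xL; rewrite !lhull_cone // => xs; apply: span_refine.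
rewrite lhull_cone // (_ : [set s | _]%classic =
    [set cone (refine F) | F in [set` between]]%classic); last first.
  apply/seteqP; split=> s /=; first by move=> /tops[F FT ->]; exists F.
  by case=> F FT <-; apply/tops; exists F.
rewrite fsbig_image; last first.
  by move=> F H /set_mem /= FT /set_mem /= HT; apply: refine_inj.
rewrite (_ : [set` between]%classic = [set` enum between]%classic); last first.
  by apply/seteqP; split=> F /=; rewrite mem_enum.
rewrite -fsbig_seq ?enum_uniq // big_enum /= (eq_bigr (rho R G)) => [|F FT].
  exact: sum_between_span.
by rewrite uE.
Qed.

End Codim1.

Lemma Bfan_balanced : balanced_fan (latticeREL R G) (Bfan R G) (fun=> 1%N).
Proof.
split; first exact: Bfan_is_fan.
exists rk.-1; first exact: Bfan_pure.
move=> _ [c flc <-]; rewrite -/(cone c) cdim_cone // => szc.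
have lt_c := size_flat_chain flc; have [pc fl] := proj1 (flat_chainE c) flc.
have [|p [q [E rA rB]]] := chain_gap pc fl; first by rewrite mrank0; lia.
rewrite mrank0 add0n in rA rB; subst c.
by apply: codim1_balanced => //; lia.
Qed.

End Balanced.

Local Open Scope classical_set_scope.

(* The index i : 'I_n.-1 stands for the label i + 2 in {2, ..., n}. *)
Theorem theorem3p28 (R : realType) (n : nat) (n_ge4 : (4 <= n)%N)
    (G : sgraph 'I_n.-1) (G_connected : gconnected G) :
  [/\ [set piG G @` s | s in image_cones (@Psi R 'I_n.-1) (fun=> True)] =
        Bfan R G,
      identifies (@PsiG R 'I_n.-1 G) (@gstable R 'I_n.-1 G) (Bfan R G) <->
        complete_multipartite G
    & complete_multipartite G ->
        balanced_fan (latticeREL R G)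
          (image_cones (@PsiG R 'I_n.-1 G) (@gstable R 'I_n.-1 G)) (fun=> 1%N)].
Proof.
have I_gt1 : (1 < #|'I_n.-1|)%N by rewrite card_ord; case: n n_ge4 {G G_connected} => [|[|[]]].
split; first exact: piG_image_cones.
  exact: identifies_multipartite.
move=> _; rewrite image_cones_Bfan //.
exact/Bfan_balanced/edges_neq0.
Qed.
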